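(* Let $A_1,A_2$ be self-adjoint complex $n\times n$ matrices (not necessarily commuting), put $\mathbf{A}=A_1+iA_2$, and assume that all eigenvalues of $\mathbf{A}$ lie in the open unit disk $\mathbb{D}=\{z\in\mathbb{C}: |z|<1\}$. Let $\phi:\mathbb{D}\to\mathbb{D}$ be a holomorphic map, and let $\phi_*^{(n)}$ be its action on pairs $(u,k)\in\mathbb{D}\times\mathbb{Z}_{\ge 0}$ given by $$\phi_*^{(n)}(u,k)=\left(\phi(u),\ \left[\frac{k}{\deg_u\phi}\right]\right),$$ where $\deg_u\phi$ is the order of the zero of the function $z\mapsto \phi(z)-\phi(u)$ at $z=u$, and $[x]$ is the integer part of $x$. Then $$\mathrm{sp}\,\phi(\mathbf{A})=\phi_*^{(n)}(\mathrm{sp}\,\mathbf{A}),$$ where $\mathrm{sp}$ is the spectrum, a multiset of $n$ pairs in $\mathbb{D}\times\mathbb{Z}_{\ge0}$, defined in the context.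
   Context: For a complex $n\times n$ matrix $\mathbf{B}$ whose eigenvalues all lie in $\mathbb{D}$, the spectrum $\mathrm{sp}\,\mathbf{B}$ is the multiset of exactly $n$ pairs $(u_i,k_i)$, $1\le i\le n$, $u_i\in\mathbb{D}$, $k_i\in\mathbb{Z}_{\ge 0}$ (some of the pairs may coincide), determined by the Jordan normal form of $\mathbf{B}$: each Jordan block of length $\ell$ with eigenvalue $u$ contributes the $\ell$ pairs $(u,0),(u,1),\ldots,(u,\ell-1)$, one for each root vector of the block (for example, a single Jordan block of length 2 with eigenvalue $0$ has spectrum $\{(0,0),(0,1)\}$), and $\mathrm{sp}\,\mathbf{B}$ is the union, with multiplicities, over all Jordan blocks. $\phi(\mathbf{A})$ is defined by the holomorphic functional calculus for matrices. The image $\phi_*^{(n)}(\mathrm{sp}\,\mathbf{A})$ is the multiset image, i.e. $\phi_*^{(n)}$ is applied to each of the $n$ pairs, retaining multiplicities. If $\phi$ is constant, then $\deg_u\phi=\infty$ and $[k/\infty]=0$. *)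

(* Defs.v *)
From HB Require Import structures.
From mathcomp Require Import all_boot all_order all_algebra.
From mathcomp Require Import finmap multiset complex.
From mathcomp Require Import all_classical all_reals all_analysis.

Set Implicit Arguments.
Unset Strict Implicit.
Unset Printing Implicit Defensive.

Import Order.TTheory GRing.Theory Num.Theory.
Import numFieldNormedType.Exports.

Local Open Scope classical_set_scope.
Local Open Scope ring_scope.
Local Open Scope complex_scope.

Section Spectrum.
Variable K : closedFieldType.

Definition jordan_block (u : K) (l : nat) : 'M[K]_l :=
  \matrix_(i, j) (u *+ (j == i) + (j == i.+1 :> nat)%:R).

(* The block sizes only add up to n propositionally, hence the cast. *)
Definition is_jordan_form n (B : 'M[K]_n) m (u : 'I_m -> K)
    (l : 'I_m -> nat) : Prop :=
  (forall i, 0 < l i)%N /\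
  exists e : (\sum_i l i)%N = n,
    B ~_{in unitmx} castmx (e, e) (\mxdiag_i jordan_block (u i) (l i)).

Definition block_pairs m (u : 'I_m -> K) (l : 'I_m -> nat) : seq (K * nat) :=
  [seq (u i, k) | i <- enum 'I_m, k <- iota 0 (l i)].

(* Every matrix over K has a Jordan form, unique up to the order of the blocks,
   so exactly one multiset satisfies the predicate below and the default mset0
   of xget is never used. *)
Definition sp n (B : 'M[K]_n) : {mset (K * nat)%type}%mset :=
  xget mset0 [set S | exists m (u : 'I_m -> K) (l : 'I_m -> nat),
    is_jordan_form B u l /\ S = seq_mset (block_pairs u l)].

End Spectrum.

Definition mset_map (T U : choiceType) (f : T -> U) (S : {mset T}%mset) : {mset U}%mset :=
  seq_mset [seq f x | x <- S].

(* At K = R[i], derivable and derive1n are complex differentiability and the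
   complex derivatives. *)
Section Degree.
Variable K : numFieldType.

Definition holomorphic_on_disc (f : K -> K) : Prop :=
  forall z : K, `|z| < 1 -> derivable f z 1.

(* The order of a zero is the index of the first nonvanishing derivative;
   None stands for infinity. *)
Definition zero_order (f : K -> K) (u : K) : option nat :=
  if pselect (exists k, derive1n k f u != 0) is left h then Some (ex_minn h)
  else None.

Definition degree_at (phi : K -> K) (u : K) : option nat :=
  zero_order (fun z => phi z - phi u) u.

Definition phi_star (phi : K -> K) (p : K * nat) : K * nat :=
  (phi p.1, if degree_at phi p.1 is Some d then (p.2 %/ d)%N else 0%N).

End Degree.

Section FunctionalCalculus.
Variable R : realType.

Definition circle (r t : R) : R[i] := (r * cos t) +i* (r * sin t).

Definition integral02pi (g : R -> R[i]) : R[i] :=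
  (\int[lebesgue_measure]_(t in `[0, 2 * pi]) complex.Re (g t))%R +i*
  (\int[lebesgue_measure]_(t in `[0, 2 * pi]) complex.Im (g t))%R.

(* The integral of f(z) dz over the circle |z| = r, counterclockwise; here
   dz = i z dt along z = circle r t. *)
Definition circle_integral (r : R) (f : R[i] -> R[i]) : R[i] :=
  integral02pi (fun t => f (circle r t) * ('i%C * circle r t)).

(* The circle |z| = r is an admissible contour for the Cauchy integral defining
   phi(A), phi being holomorphic on the open unit disc: it lies in the disc and
   encloses all the eigenvalues of A. *)
Definition admissible_radius n (A : 'M[R[i]]_n) (r : R) : Prop :=
  [/\ 0 < r, r < 1 & forall z : R[i], eigenvalue A z -> `|z| < r%:C].

(* phi(A) as the Cauchy integral of phi(z) (z - A)^-1 dz / (2 pi i), entrywise;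
   its value does not depend on the admissible r. *)
Definition holo_calculus (r : R) (phi : R[i] -> R[i]) n (A : 'M[R[i]]_n) :
    'M[R[i]]_n :=
  \matrix_(i, j) ((2 * pi%:C * 'i%C)^-1 *
    circle_integral r (fun z => phi z * invmx (z%:M - A) i j)).

End FunctionalCalculus.

(* Main.v *)
(* Both spectra can be read off ranks: the pair (v, k) occurs in sp B with
   multiplicity rank((B - v)^k) - rank((B - v)^(k+1)).  On a Jordan block
   u + N the Cauchy integral gives phi(u) + sum_(k > 0) phi^(k)(u) / k! N^k,
   that is phi(u) + N^d U with d = deg_u phi and U invertible and commuting
   with N, so the ranks of the powers of phi(u + N) - phi(u) are those of the
   powers of N^d; this is the effect of k |-> [k / d] on the block.

   The Taylor coefficients come out of the resolvent entries (z - u)^-(k+1) and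
   Cauchy's formula.  For the latter, Goursat's bisection argument is run on
   the homotopy u + s (r e^(it) - u) from the circle to the point u, applied to
   (phi(z) - phi(u)) / (z - u); the derivatives then follow by differentiating
   the Cauchy integral in u. *)
Require Import Defs.
From HB Require Import structures.
From mathcomp Require Import all_boot all_order all_algebra.
From mathcomp Require Import finmap multiset complex.
From mathcomp Require Import all_classical all_reals all_analysis.
From mathcomp Require Import zify ring lra.

Set Implicit Arguments.
Unset Strict Implicit.
Unset Printing Implicit Defensive.

Import Order.TTheory GRing.Theory Num.Theory.
Import numFieldNormedType.Exports.

Local Open Scope ring_scope.
Local Open Scope complex_scope.

(** * Toeplitz matrices and the Jordan form *)

Section Toeplitz.
Variable K : fieldType.

(** Since [sp] chooses among Jordan forms, the rank description rests on two facts: every matrix has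
    a Jordan form, obtained by splitting off one chain at a time with an invariant complement, and
    all its Jordan forms give the same multiset. The Jordan form of phi(A) is never computed: the
    matrix that conjugates A to Jordan blocks conjugates phi(A) to triangular Toeplitz blocks, and
    then only ranks are compared. On the analytic side, (phi(z) - phi(u)) / (z - u) is not known to
    be differentiable at u, so the homotopy has to avoid u. It stops at a small closed curve around
    u, where the quotient is bounded, and the length of that curve can be made arbitrarily small.
    Derivatives are taken on the whole real line, so s is a function of a real variable with values
    in ]0, 1], not a variable confined to an interval. *)

Definition toeplitz l (c : nat -> K) : 'M[K]_l :=
  \matrix_(i, j) (if (i <= j)%N then c (j - i)%N else 0).

Definition shift_mx l m : 'M[K]_l := \matrix_(i, j) (j == i + m :> nat)%N%:R.

(** The selected index may fall outside the block after a shift; [insub] is then [None] and the sum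
    is 0. *)
Lemma sum_indicator l (F : 'I_l -> K) n :
  \sum_(k < l) (k == n :> nat)%N%:R * F k = oapp F 0 (insub n).
Proof.
case: insubP => [k0 _ /= <-|] /=.
  rewrite (bigD1 k0) //= eqxx mul1r big1 ?addr0 // => k.
  by rewrite -val_eqE => /negbTE /= ->; rewrite mul0r.
rewrite -leqNgt => ln; rewrite big1 // => k _.
by rewrite ltn_eqF ?mul0r // (leq_trans (ltn_ord k)).
Qed.

Lemma shift_mxD l m n : shift_mx l m *m shift_mx l n = shift_mx l (m + n).
Proof.
apply/matrixP => i j; rewrite !mxE.
under eq_bigr do rewrite !mxE; rewrite sum_indicator.
case: insubP => [k0 _ /= ->|] /=; first by rewrite addnA.
rewrite -leqNgt => h; rewrite ltn_eqF // (leq_trans (ltn_ord j)) //.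
by rewrite addnA (leq_trans h) // leq_addr.
Qed.

Lemma shift_mx0 l : shift_mx l 0 = 1%:M.
Proof. by apply/matrixP => i j; rewrite !mxE addn0 -val_eqE eq_sym. Qed.

Lemma shift_mxX l m k : shift_mx l m ^+ k = shift_mx l (m * k).
Proof.
elim: k => [|k IH]; first by rewrite expr0 muln0 shift_mx0.
by rewrite exprS IH -[_ * _]/(_ *m _) shift_mxD mulnS.
Qed.

(** Multiplying by the transpose gives [pid_mx (l - m)], which bounds the rank from below; the
    matrix is also unchanged by [pid_mx (l - m)] on the left, which bounds it from above. Truncated
    subtraction covers shifts beyond the block size. *)
Lemma rank_shift_mx l m : \rank (shift_mx l m) = (l - m)%N.
Proof.
have e : shift_mx l m *m (shift_mx l m)^T = pid_mx (l - m).
  apply/matrixP => i j; rewrite !mxE.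
  under eq_bigr do rewrite !mxE; rewrite sum_indicator.
  case: insubP => [k0 hk /= ->|] /=.
    have -> : (i < l - m)%N by lia.
    by rewrite andbT eqn_add2r.
  by rewrite -leqNgt => h; rewrite (_ : (i < l - m)%N = false); last lia; rewrite andbF.
apply/eqP; rewrite eqn_leq; apply/andP; split; last first.
  have := mxrankM_maxl (shift_mx l m) (shift_mx l m)^T.
  by rewrite e rank_pid_mx ?leq_subr.
have h : pid_mx (l - m) *m shift_mx l m = shift_mx l m.
  apply/matrixP => i j; rewrite !mxE.
  under eq_bigr => k _ do
    rewrite !mxE eq_sym -mulnb natrM -mulrA.
  rewrite sum_indicator insubT //= => hi.
  case: eqP => [ej|]; last by rewrite mulr0.
  have -> : (i < l - m)%N by have := ltn_ord j; lia.
  by rewrite mulr1.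
by rewrite -h (leq_trans (mxrankM_maxl _ _)) // rank_pid_mx ?leq_subr.
Qed.

Lemma toeplitz_unit l c : c 0%N != 0 -> toeplitz l c \in unitmx.
Proof.
move=> c0; rewrite -unitmx_tr unitmxE det_trig.
  rewrite unitfE; apply/prodf_neq0 => i _.
  by rewrite !mxE leqnn subnn.
by apply/is_trig_mxP => i j ij; rewrite !mxE leqNgt ij.
Qed.

Lemma toeplitz_subC l c v :
  toeplitz l c - v%:M = toeplitz l (fun k => c k - v *+ (k == 0%N)).
Proof.
apply/matrixP => i j; rewrite !mxE -val_eqE /=.
case: leqP => [ij|ji]; last by rewrite gtn_eqF ?subr0.
by congr (_ - _ *+ _); rewrite subn_eq0 eqn_leq ij.
Qed.

Lemma toeplitz_shift l c d : (forall k, (k < d)%N -> c k = 0) ->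
  toeplitz l c = shift_mx l d *m toeplitz l (fun k => c (d + k)%N).
Proof.
move=> c0; apply/matrixP => i j; rewrite !mxE.
under eq_bigr do rewrite !mxE; rewrite sum_indicator.
case: insubP => [k0 hk /= ->|] /=.
  case: leqP => ij; last by case: leqP => // h; lia.
  case: leqP => h; last by rewrite c0 //; lia.
  by congr c; lia.
rewrite -leqNgt => h; case: leqP => // ij; rewrite c0 //.
by have := ltn_ord j; lia.
Qed.

Lemma toeplitz_shiftC l c d :
  toeplitz l c *m shift_mx l d = shift_mx l d *m toeplitz l c.
Proof.
apply/matrixP => i j; rewrite !mxE.
under eq_bigr do rewrite !mxE mulrC.
under [in RHS]eq_bigr do rewrite !mxE; rewrite sum_indicator.
case: (leqP d j) => dj.
  under eq_bigr => k _.
    have -> : (j == k + d :> nat)%N = (k == j - d :> nat)%N by lia.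
    over.
  rewrite sum_indicator insubT /=; first by have := ltn_ord j; lia.
  move=> h; case: insubP => [k0 hk /= ->|] /=.
    by rewrite (_ : (i <= j - d)%N = (i + d <= j)%N); last lia; rewrite -subnDA addnC.
  by rewrite -leqNgt => h'; case: leqP => // ij; have := ltn_ord j; lia.
rewrite big1 => [|k _].
  case: insubP => [k0 hk /= ->|] //=.
  by case: leqP => // h; lia.
by rewrite (_ : (j == k + d :> nat)%N = false); last lia; rewrite mul0r.
Qed.

Lemma unitmxX l (U : 'M[K]_l) k : U \in unitmx -> U ^+ k \in unitmx.
Proof.
move=> uU; elim: k => [|k IH]; first by rewrite expr0 unitmx1.
by rewrite exprS -[_ * _]/(_ *m _) unitmx_mul uU.
Qed.

Lemma rank_unitX l (U : 'M[K]_l) k : U \in unitmx -> \rank (U ^+ k) = l.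
Proof. by move=> uU; apply: mxrank_unit; rewrite unitmxX. Qed.

Lemma rank_0X l k : \rank ((0 : 'M[K]_l) ^+ k) = (l * (k == 0))%N.
Proof.
case: k => [|k]; first by rewrite expr0 mxrank1 muln1.
by rewrite exprS mul0r mxrank0 muln0.
Qed.

Lemma rank_toeplitzX l c d k :
    (forall j, (j < d)%N -> c j = 0) -> c d != 0 ->
  \rank (toeplitz l c ^+ k) = (l - d * k)%N.
Proof.
move=> c0 cd; rewrite (toeplitz_shift _ c0) -[_ *m _]/(_ * _).
set U := toeplitz _ _.
have uU : U \in unitmx by apply: toeplitz_unit; rewrite addn0.
rewrite exprMn_comm; last by rewrite /GRing.comm -[RHS]/(_ *m _) toeplitz_shiftC.
rewrite shift_mxX -[_ * _]/(_ *m _) mxrankMfree ?rank_shift_mx //.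
by rewrite row_free_unit unitmxX.
Qed.

(** The order of the zero of the power series with coefficients [c] once its constant term is
    removed. Index 0 is skipped because [c 0] is the eigenvalue of the block. *)
Definition order_spec (c : nat -> K) (o : option nat) : Prop :=
  if o is Some d then
    [/\ (0 < d)%N, forall j, (0 < j < d)%N -> c j = 0 & c d != 0]
  else forall j, (0 < j)%N -> c j = 0.

Definition div_order (k : nat) (o : option nat) : nat :=
  if o is Some d then (k %/ d)%N else 0%N.

(** The [j] with quotient [k] fill the interval from [d * k] to [d * k.+1]; the truncated
    differences cut it off at [l]. *)
Lemma count_divn l d k : (0 < d)%N ->
  count (fun j => j %/ d == k)%N (iota 0 l) = ((l - d * k) - (l - d * k.+1))%N.
Proof.
move=> d0; elim: l => [//|l IH].
rewrite -addn1 iotaD count_cat IH /= add0n addn0.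
have h : (l %/ d == k)%N = (d * k <= l < d * k.+1)%N.
  rewrite eqn_leq -ltnS ltn_divLR // leq_divRL //.
  by rewrite mulnC (mulnC k) andbC.
rewrite h mulnS; case: leqP; case: ltnP => /=; lia.
Qed.

Lemma count_toeplitz l c o (v : K) k : order_spec c o ->
  count (fun j => (c 0%N, div_order j o) == (v, k)) (iota 0 l) =
  (\rank ((toeplitz l c - v%:M) ^+ k) - \rank ((toeplitz l c - v%:M) ^+ k.+1))%N.
Proof.
move=> oP; rewrite toeplitz_subC.
have [e|ne] := eqVneq (c 0%N) v; last first.
  rewrite !rank_unitX ?subnn; try by apply: toeplitz_unit; rewrite eqxx subr_eq0.
  rewrite (@eq_count _ _ pred0) ?count_pred0 // => j /=.
  by rewrite xpair_eqE (negbTE ne).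
under eq_count => j do rewrite xpair_eqE e eqxx /=.
case: o oP => [d|] /=.
  move=> [d0 c0 cd].
  rewrite !(@rank_toeplitzX _ _ d); first exact: count_divn.
  - by case=> [|j] jd; rewrite ?eqxx ?e ?subrr //= subr0 c0.
  - by case: d d0 cd {c0} => // d _; rewrite subr0.
  - by case=> [|j] jd; rewrite ?eqxx ?e ?subrr //= subr0 c0.
  - by case: d d0 cd {c0} => // d _; rewrite subr0.
(* With no nonzero higher coefficient [T] vanishes. Its power 0 is still the identity, of rank [l],
   which accounts for all [l] pairs at [k = 0]. *)
move=> c0; set T := toeplitz _ _.
have -> : T = 0.
  apply/matrixP => i j; rewrite !mxE; case: leqP => // _.
  by case: (j - i)%N => [|m] /=; rewrite ?e ?subrr // subr0 c0.
rewrite !rank_0X muln0 subn0; case: k => [|k] /=.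
  by rewrite count_predT size_iota muln1.
by rewrite count_pred0 muln0.
Qed.

End Toeplitz.

(** * Spectra and ranks *)

Section Spectrum.
Variable K : closedFieldType.

Lemma jordan_block_toeplitz (u : K) l :
  jordan_block u l = toeplitz l (fun k => if k is k'.+1 then (k' == 0%N)%:R else u).
Proof.
apply/matrixP => i j; rewrite !mxE -val_eqE /=.
case: (ltngtP i j) => [ij|ji|->].
- rewrite add0r; case E: (j - i)%N => [|k]; first by lia.
  by congr (_ %:R); lia.
- by rewrite add0r (_ : (_ == _) = false) //; lia.
- by rewrite subnn (_ : (_ == _) = false) ?addr0 //; lia.
Qed.

Lemma jordan_block_spec (u : K) :
  order_spec (fun k => if k is k'.+1 then (k' == 0%N)%:R else u) (Some 1%N).
Proof. by split=> //= [[|j] //|]; rewrite oner_neq0. Qed.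

(** Unlike in [is_jordan_form], the blocks are arbitrary, so that the Toeplitz blocks of phi(A) fit
    as well. *)
Definition block_similar n (B : 'M[K]_n) m (l : 'I_m -> nat)
    (T : forall i, 'M[K]_(l i)) : Prop :=
  exists e : (\sum_i l i)%N = n,
    B ~_{in unitmx} castmx (e, e) (\mxdiag_i T i).

Lemma mxdiagX m (l : 'I_m -> nat) (T : forall i, 'M[K]_(l i)) k :
  (\mxdiag_i T i) ^+ k = \mxdiag_i (T i ^+ k).
Proof.
elim: k => [|k IH].
  by rewrite expr0 -[1]/(1%:M) -(mxdiagZ 1); apply: eq_mxdiag => i; rewrite expr0.
rewrite exprS IH -[_ * _]/(_ *m _) {2}/mxdiag mul_mxdiag_mxblock.
apply/eq_mxblock => i j; case: eqVneq => [->|]; last by rewrite mulmx0.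
by rewrite !conform_mx_id exprS.
Qed.

Lemma conjmxX n (P B : 'M[K]_n) k : P \in unitmx ->
  (invmx P *m B *m P) ^+ k = invmx P *m B ^+ k *m P.
Proof.
move=> uP; elim: k => [|k IH]; first by rewrite !expr0 mulmx1 mulVmx.
rewrite !exprS IH -![_ * _]/(_ *m _) -!mulmxA; congr (_ *m (_ *m _)).
by rewrite !mulmxA mulmxV // mul1mx.
Qed.

Lemma block_similarE n (B : 'M[K]_n) m (l : 'I_m -> nat) T :
  @block_similar n B m l T ->
  exists e : (\sum_i l i)%N = n, exists2 P, P \in unitmx &
    B = invmx P *m castmx (e, e) (\mxdiag_i T i) *m P.
Proof.
move=> [e [P uP /(simmxP uP) h]]; exists e, P => //.
by rewrite -mulmxA -h mulKmx.
Qed.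

Lemma rank_block_similar n (B : 'M[K]_n) m (l : 'I_m -> nat) T v k :
  @block_similar n B m l T ->
  \rank ((B - v%:M) ^+ k) = (\sum_i \rank ((T i - v%:M) ^+ k))%N.
Proof.
move=> /block_similarE [e [P uP ->]]; subst n; rewrite castmx_id.
have -> : v%:M = invmx P *m v%:M *m P.
  by rewrite scalar_mxC -mulmxA mulVmx // mulmx1.
rewrite -mulmxBl -mulmxBr conjmxX // mxrankMfree ?row_free_unit //.
rewrite -mxrank_tr trmx_mul mxrankMfree ?row_free_unit ?unitmx_tr ?unitmx_inv //.
rewrite mxrank_tr -(mxdiagZ v) -mxdiagB mxdiagX; exact: rank_mxdiag.
Qed.

Lemma rank_X_leq n (B : 'M[K]_n) k : (\rank (B ^+ k.+1) <= \rank (B ^+ k))%N.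
Proof. by rewrite exprS; apply: mxrankM_maxr. Qed.

Lemma count_block_pairs (p : pred (K * nat)) m (u : 'I_m -> K) l :
  count p (block_pairs u l) = (\sum_i count (fun k => p (u i, k)) (iota 0 (l i)))%N.
Proof.
rewrite /block_pairs -[index_enum _]enumT.
elim: (enum _) => [|i s IH]; first by rewrite big_nil.
by rewrite big_cons /= count_cat IH count_map.
Qed.

(** Serves twice: with [g] the identity and order 1 it computes the spectrum of a matrix from its
    own Jordan form, and with the action of phi as [g] it computes the image of sp A from the blocks
    of phi(A). *)
Lemma count_block_similar n (B : 'M[K]_n) m (u : 'I_m -> K) l
    (c : 'I_m -> nat -> K) (g : K * nat -> K * nat) (o : 'I_m -> option nat) v k :
    block_similar B (fun i => toeplitz (l i) (c i)) ->
    (forall i, order_spec (c i) (o i)) ->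
    (forall i j, g (u i, j) = (c i 0%N, div_order j (o i))) ->
  count_mem (v, k) [seq g x | x <- block_pairs u l] =
  (\rank ((B - v%:M) ^+ k) - \rank ((B - v%:M) ^+ k.+1))%N.
Proof.
(* Truncated subtraction passes through the sum because in each block the rank does not increase
   with the exponent. *)
move=> sB oP gE; rewrite !(rank_block_similar _ _ sB) -sumnB; last first.
  by move=> i _; apply: rank_X_leq.
rewrite count_map count_block_pairs; apply: eq_bigr => i _.
by rewrite -(count_toeplitz _ _ _ (oP i)); apply: eq_count => j /=; rewrite gE.
Qed.

Lemma jordan_form_toeplitz n (B : 'M[K]_n) m (u : 'I_m -> K) l :
  is_jordan_form B u l -> block_similar B (fun i => toeplitz (l i)
    (fun k => if k is k'.+1 then (k' == 0%N)%:R else u i)).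
Proof.
move=> [_ [e h]]; exists e.
by under eq_mxdiag do rewrite -jordan_block_toeplitz.
Qed.

Lemma count_jordan_form n (B : 'M[K]_n) m (u : 'I_m -> K) l v k :
  is_jordan_form B u l -> count_mem (v, k) (block_pairs u l) =
  (\rank ((B - v%:M) ^+ k) - \rank ((B - v%:M) ^+ k.+1))%N.
Proof.
move=> /jordan_form_toeplitz sB; rewrite -[block_pairs u l]map_id.
apply: (count_block_similar (o := fun=> Some 1%N) _ _ sB) => [i|i j] /=.
  exact: jordan_block_spec.
by rewrite divn1.
Qed.

(** * Existence of the Jordan form *)

Section Chain.
Variables (n : nat) (A : 'M[K]_n).

Definition chain (u : K) (l : nat) (v : 'rV[K]_n) : 'M[K]_(l, n) :=
  \matrix_(k < l) (v *m (A - u%:M) ^+ k).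

(** Multiplication by [A - u] moves every row of the chain to the next one and kills the last, just
    as the ones above the diagonal of the block do. *)
Lemma chain_mulmx u l v : v *m (A - u%:M) ^+ l = 0 ->
  chain u l v *m A = jordan_block u l *m chain u l v.
Proof.
move=> vl; rewrite -[X in _ *m X = _](subrK u%:M) mulmxDr.
have -> : jordan_block u l = shift_mx K l 1 + u%:M.
  apply/matrixP => i j; rewrite !mxE addn1 addrC; congr (_ + _ *+ _).
  by rewrite eq_sym.
rewrite mulmxDl scalar_mxC; congr (_ + _).
apply/row_matrixP => i; rewrite !row_mul rowK -mulmxA -[_ *m (A - _)]exprSr.
apply/rowP => j; rewrite [RHS]mxE.
under eq_bigr do rewrite !mxE; rewrite sum_indicator addn1.
case: insubP => [k0 hk /= ->|] /=; first by rewrite mxE.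
rewrite -leqNgt => h; have -> : i.+1 = l by have := ltn_ord i; lia.
by rewrite vl mxE.
Qed.

End Chain.

Lemma eigenvalue_exists n (A : 'M[K]_n) : (0 < n)%N -> exists u, eigenvalue A u.
Proof.
move=> n0; have /closed_rootP [u] : size (char_poly A) != 1%N.
  by rewrite size_char_poly eqSS -lt0n.
by rewrite -eigenvalue_root_char => h; exists u.
Qed.

(* [m] is the index at which the kernels of the powers of [B] stabilise. *)
Lemma dual_chain_exists n (B : 'M[K]_n) : B \notin unitmx ->
  exists m (v : 'rV[K]_n) (f : 'cV[K]_n),
    [/\ v *m B ^+ m.+1 = 0, B ^+ m.+1 *m f = 0 & v *m B ^+ m *m f = 1%:M].
Proof.
move=> nuB; pose s k := \rank (B ^+ k).
have s_leq k : (s k.+1 <= s k)%N by apply: rank_X_leq.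
have [m0 hm0] : exists m, s m.+2 == s m.+1.
  apply: contrapT => /forallNP h.
  have : forall k, (s k.+1 + k <= s 1%N)%N.
    elim=> [|k IH]; first by rewrite addn0.
    by have /negP := h k; have := s_leq k.+1; lia.
  by move/(_ (s 1%N).+1); lia.
have [m /eqP hm mmin] := ex_minnP (ex_intro (fun m => s m.+2 == s m.+1) m0 hm0).
(* The rank still drops just before it stabilises: by singularity of [B] if [m = 0], by minimality
   of [m] otherwise. *)
have sm : (s m.+1 < s m)%N.
  case: m hm mmin => [|m] hm mmin.
    rewrite /s expr1 expr0 mxrank1 ltn_neqAle rank_leq_row andbT.
    by move: nuB; rewrite -row_free_unit.
  by rewrite ltn_neqAle s_leq andbT; apply/negP => /mmin; rewrite ltnn.
have ker_stable x : x *m B ^+ m.+2 = 0 :> 'rV[K]_n -> x *m B ^+ m.+1 = 0.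
  move=> /sub_kermxP hx; apply/sub_kermxP; apply: submx_trans hx _.
  rewrite -(geq_leqif (mxrank_leqif_sup _)).
    by rewrite !mxrank_ker -/(s _) -/(s _) hm.
  by apply/sub_kermxP; rewrite (exprSr B m.+1) -[_ * B]/(_ *m _) mulmxA mulmx_ker mul0mx.
have [v vm vm1] : exists2 v : 'rV[K]_n, v *m B ^+ m.+1 = 0 & v *m B ^+ m != 0.
  have : ~~ (kermx (B ^+ m.+1) <= kermx (B ^+ m))%MS.
    apply/negP => /mxrankS; rewrite !mxrank_ker -/(s _) -/(s _).
    by have := rank_leq_row (B ^+ m); rewrite -/(s m); lia.
  case/row_subPn => i hi; exists (row i (kermx (B ^+ m.+1))).
    by apply/sub_kermxP; rewrite row_sub.
  by apply/negP => /eqP/sub_kermxP; apply/negP.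
(* If v B^m = x B^(m+1), then x B^(m+2) = v B^(m+1) = 0, so x B^(m+1) = 0 by stability,
   contradicting v B^m <> 0. *)
have nsub : ~~ (v *m B ^+ m <= B ^+ m.+1)%MS.
  apply/negP => /submxP [x hx]; case/eqP: vm1; rewrite hx.
  apply: ker_stable; rewrite (exprSr B m.+1) -[_ * B]/(_ *m _) mulmxA.
  by rewrite -hx -mulmxA -[B ^+ m *m B]exprSr.
move: nsub; rewrite submxE => /matrix0Pn [i [j]]; rewrite ord1 => hij.
(* A column of the cokernel is a functional that vanishes on the image of B^(m+1) but not on v B^m;
   dividing by its value [a] there normalises it. *)
pose a := (v *m B ^+ m *m cokermx (B ^+ m.+1)) 0 j.
exists m, v, (a^-1 *: col j (cokermx (B ^+ m.+1))); split => //.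
  by rewrite -scalemxAr colE mulmxA mulmx_coker mul0mx scaler0.
rewrite -scalemxAr colE mulmxA -colE; apply/matrixP => i' j'.
by rewrite !ord1 mxE [X in _ * X]mxE mulVf // mxE.
Qed.

Lemma chain_mulmxr n p (A : 'M[K]_n) (A' : 'M[K]_p) (W : 'M[K]_(p, n)) u k
    (x : 'rV[K]_p) :
  W *m A = A' *m W -> x *m W *m (A - u%:M) ^+ k = x *m (A' - u%:M) ^+ k *m W.
Proof.
move=> WA; have WB : W *m (A - u%:M) = (A' - u%:M) *m W.
  by rewrite mulmxBr mulmxBl WA scalar_mxC.
elim: k => [|k IH]; first by rewrite !expr0 !mulmx1.
by rewrite !exprSr -![_ * _]/(_ *m _) !mulmxA IH -!mulmxA WB.
Qed.

(** Chains found in the coordinates of an invariant subspace with basis [W] become chains of [A]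
    after multiplication by [W]; this carries the induction on the dimension back to the whole
    space. *)
Lemma sum_chain_mulmxr n p (A : 'M[K]_n) (A' : 'M[K]_p) (W : 'M[K]_(p, n))
    (s : seq (K * nat * 'rV[K]_p)) :
    W *m A = A' *m W ->
  ((\sum_(x <- s) <<chain A' x.1.1 x.1.2 x.2>>)%MS *m W <=
   \sum_(x <- s) <<chain A x.1.1 x.1.2 (x.2 *m W)>>)%MS.
Proof.
move=> WA; elim: s => [|x s IH]; first by rewrite !big_nil mul0mx sub0mx.
rewrite !big_cons addsmxMr addsmxS // genmxE (eqmxMr _ (genmxE _)).
apply/row_subP => i; rewrite row_mul rowK -(chain_mulmxr _ _ _ WA).
by apply: (eq_row_sub i); rewrite rowK.
Qed.

(* The complement [W] of the chain is the common kernel of the functionals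
   [x |-> x B^j f] for the dual chain of [f], where [B = A - u]. *)
Lemma split_chain n (A : 'M[K]_n) u : eigenvalue A u ->
  exists l v p (W : 'M[K]_(p, n)) (A' : 'M[K]_p),
    [/\ [/\ (0 < l)%N, (l + p)%N = n & W *m A = A' *m W],
        v *m (A - u%:M) ^+ l = 0 & row_full (chain A u l v + W)%MS].
Proof.
move=> /eigenvalueP [x xA x0]; set B := A - u%:M.
have nuB : B \notin unitmx.
  apply/negP => uB; case/eqP: x0; rewrite -[x](mulmxK uB) mulmxBr xA.
  by rewrite mul_mx_scalar subrr mul0mx.
have [m [v [f [vm fm vmf]]]] := dual_chain_exists nuB.
(* The exponents decrease with the column so that entry (i, j) of [T = C *m F] is v B^(m+i-j) f: it
   is 1 on the diagonal and 0 below it, whence [T] is invertible and both factors have rank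
   [m.+1]. *)
pose F : 'M[K]_(n, m.+1) := \matrix_(i, j) (B ^+ (m - j) *m f) i 0.
have colF (j : 'I_m.+1) : col j F = B ^+ (m - j) *m f.
  by apply/colP => i; rewrite !mxE.
have fB k : (m < k)%N -> B ^+ k *m f = 0.
  move=> mk; rewrite -(subnK mk) exprD -[_ * _]/(_ *m _) -mulmxA.
  by rewrite fm mulmx0.
pose C := chain A u m.+1 v; pose T := C *m F.
have TE i j : T i j = (v *m (B ^+ (i + (m - j)) *m f)) 0 0.
  rewrite exprD -[_ * _]/(_ *m _) -[X in v *m X]mulmxA mulmxA -colF.
  by rewrite !mxE; apply: eq_bigr => k _; rewrite !mxE.
have TCF : T = C *m F by [].
clearbody T; have uT : T \in unitmx.
  rewrite -unitmx_tr unitmxE det_trig.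
    rewrite unitfE; apply/prodf_neq0 => i _.
    have -> : T^T i i = T i i by rewrite mxE.
    have im : (i <= m)%N by rewrite -ltnS.
    rewrite TE subnKC //.
    rewrite mulmxA vmf.
    rewrite mxE eqxx.
    exact: oner_neq0.
  apply/is_trig_mxP => i j ij; rewrite mxE TE fB ?mulmx0 ?mxE //.
  by have := ltn_ord i; lia.
have rF : \rank F = m.+1.
  apply/eqP; rewrite eqn_leq rank_leq_col /=.
  by have := mxrankM_maxr C F; rewrite -TCF mxrank_unit.
have rC : \rank C = m.+1.
  apply/eqP; rewrite eqn_leq rank_leq_row /=.
  by have := mxrankM_maxl C F; rewrite -TCF mxrank_unit.
(* [B] only shifts the columns of [F], so the kernel of [F] is stable under [B], hence under [A]. *)
have BF : B *m F = F *m shift_mx K m.+1 1.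
  apply/matrixP => i j; rewrite -[B]expr1 [RHS]mxE.
  transitivity ((B ^+ (1 + (m - j)) *m f) i 0).
    rewrite exprD -[_ * _]/(_ *m _) -mulmxA -colF !mxE.
    by apply: eq_bigr => k _; rewrite [col j F k 0]mxE.
  under eq_bigr do rewrite [shift_mx _ _ _ _ _]mxE mulrC.
  case: j => -[|j] /= hj.
    rewrite [RHS]big1 => [|k _]; last by rewrite addn1 mul0r.
    by rewrite subn0 add1n fm mxE.
  under eq_bigr do rewrite addn1 eqSS eq_sym.
  rewrite sum_indicator insubT /=; first by lia.
  by move=> h; rewrite [RHS]mxE /= add1n subnSK.
pose W := row_base (kermx F).
have stA : stablemx W A.
  rewrite (eqmx_stable _ (eq_row_base _)).
  apply/sub_kermxP; rewrite -mulmxA.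
  have AF : A *m F = F *m shift_mx K m.+1 1 + u%:M *m F.
    by rewrite -BF mulmxBl subrK.
  rewrite AF mulmxDr (mulmxA (kermx F) F) mulmx_ker mul0mx add0r.
  by rewrite -scalar_mxC mulmxA mulmx_ker mul0mx.
have CW : (C :&: W = 0)%MS.
  apply/eqP; rewrite -submx0; apply/rV_subP => y.
  rewrite sub_capmx => /andP [/submxP [z ->]].
  rewrite eq_row_base => /sub_kermxP; rewrite -mulmxA -TCF.
  move=> /(congr1 (mulmx^~ (invmx T))).
  by rewrite mulmxK // mul0mx => ->; rewrite mul0mx sub0mx.
have rk : (m.+1 + \rank (kermx F) = n)%N.
  by rewrite mxrank_ker rF subnKC // -rF rank_leq_row.
exists m.+1, v, _, W, (W *m A *m pinvmx W); split => //.
  by split => //; rewrite mulmxKpV.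
by rewrite /row_full mxrank_disjoint_sum // rC eq_row_base rk.
Qed.

(** Induction on the dimension: a chain at some eigenvalue is split off, and the complement is
    strictly smaller because the chain is nonempty. A list of triples is kept because chains of
    various lengths are easily prepended to it. *)
Lemma jordan_chains n (A : 'M[K]_n) : exists s : seq (K * nat * 'rV[K]_n),
  [/\ all (fun x => 0 < x.1.2)%N s,
      forall x, x \in s -> x.2 *m (A - x.1.1%:M) ^+ x.1.2 = 0,
      (\sum_(x <- s) x.1.2 = n)%N &
      row_full (\sum_(x <- s) <<chain A x.1.1 x.1.2 x.2>>)%MS].
Proof.
elim/ltn_ind: n A => -[|n] IH A.
  by exists [::]; split; rewrite ?big_nil // /row_full mxrank0.
have [u uA] := eigenvalue_exists A (ltn0Sn n).
have [l [v [p [W [A' [[l0 lp WA] vl CW]]]]]] := split_chain uA.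
have [|s [s0 sv sn sf]] := IH p _ A'; first by lia.
exists ((u, l, v) :: [seq (x.1, x.2 *m W) | x <- s]); split.
- by rewrite /= l0 all_map.
- move=> x; rewrite inE => /orP [/eqP -> //|/mapP [y ys ->]] /=.
  by rewrite (chain_mulmxr _ _ _ WA) sv // mul0mx.
- by rewrite big_cons big_map /= sn.
rewrite -sub1mx; move: CW; rewrite -sub1mx => /submx_trans; apply.
rewrite big_cons big_map /= addsmxS ?genmxE //.
apply: submx_trans (sum_chain_mulmxr s WA).
by rewrite -{1}[W]mul1mx submxMr // sub1mx.
Qed.

Lemma basis_similar N n (e : N = n) (A : 'M[K]_n) (J : 'M[K]_N) (P : 'M[K]_(N, n)) :
  row_full P -> P *m A = J *m P -> A ~_{in unitmx} castmx (e, e) J.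
Proof.
case: _ / e A P => A P Pf PA; rewrite castmx_id; exists P.
  by rewrite -row_full_unit.
by apply: simmxW; rewrite // row_free_unit -row_full_unit.
Qed.

Lemma jordan_form_exists n (A : 'M[K]_n) :
  exists m (u : 'I_m -> K) (l : 'I_m -> nat), is_jordan_form A u l.
Proof.
have [s [s0 sv sn sf]] := jordan_chains A.
pose x i := tnth (in_tuple s) i.
have xs i : x i \in s by apply: mem_tnth.
exists (size s), (fun i => (x i).1.1), (fun i => (x i).1.2); split.
  by move=> i; apply: (allP s0).
have e : (\sum_i (x i).1.2 = n)%N.
  by apply: etrans sn; rewrite [RHS]big_tnth.
exists e; pose P := \mxcol_i chain A (x i).1.1 (x i).1.2 (x i).2.
have PA : P *m A = (\mxdiag_i jordan_block (x i).1.1 (x i).1.2) *m P.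
  rewrite mul_mxdiag_mxcol mxcol_mul; apply: eq_mxcol => i.
  by apply: chain_mulmx; apply: sv.
have Pf : row_full P.
  by move: sf; rewrite -!sub1mx eqmx_col big_tnth.
exact: basis_similar Pf PA.
Qed.

(** By [count_jordan_form] the multiplicities depend on the ranks of powers of [B - v] alone, so all
    Jordan forms of [B] give one multiset, and [xget] returns it. *)
Lemma sp_jordan_form n (B : 'M[K]_n) m (u : 'I_m -> K) l :
  is_jordan_form B u l -> sp B = seq_mset (block_pairs u l).
Proof.
move=> jB; apply: xget_unique; first by exists m, u, l.
move=> S [m' [u' [l' [jB' ->]]]]; apply/msetP => -[v k].
by rewrite !mset_seqE (count_jordan_form _ _ jB) (count_jordan_form _ _ jB').
Qed.

(** The same rank difference computes a multiplicity in the spectrum of [B] and in the image under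
    [g] of the spectrum of [A]. The Jordan form of [B] enters only through its existence. *)
Lemma sp_block_similar n (A B : 'M[K]_n) m (u : 'I_m -> K) l
    (c : 'I_m -> nat -> K) (g : K * nat -> K * nat) (o : 'I_m -> option nat) :
    is_jordan_form A u l ->
    block_similar B (fun i => toeplitz (l i) (c i)) ->
    (forall i, order_spec (c i) (o i)) ->
    (forall i j, g (u i, j) = (c i 0%N, div_order j (o i))) ->
  sp B = mset_map g (sp A).
Proof.
move=> jA sB oP gE; have [m' [u' [l' jB]]] := jordan_form_exists B.
rewrite (sp_jordan_form jB) (sp_jordan_form jA) /mset_map.
apply/eq_seq_msetP.
apply: (@perm_trans _ [seq g x | x <- block_pairs u l]); last first.
  by rewrite perm_sym perm_map // perm_eq_seq_mset.
apply/allP => -[v k] _ /=.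
by rewrite (count_jordan_form _ _ jB) (count_block_similar _ _ sB oP gE).
Qed.

End Spectrum.

(** * Integrals of complex functions of a real variable *)

Section RealIntegral.
Variable R : realType.
Local Notation mu := (@lebesgue_measure R).
Implicit Types (f g : R -> R) (a b c M : R).

Definition rint a b f : R := (\int[mu]_(t in `[a, b]%classic) f t)%R.

Lemma integrable_itv a b f : continuous f -> mu.-integrable `[a, b]%classic (EFin \o f).
Proof.
move=> cf; apply: continuous_compact_integrable; first exact: segment_compact.
exact: continuous_subspaceT.
Qed.

Lemma rintD a b f g : continuous f -> continuous g ->
  rint a b (fun t => f t + g t) = rint a b f + rint a b g.
Proof. by move=> cf cg; apply: RintegralD => //; apply: integrable_itv. Qed.

Lemma rintB a b f g : continuous f -> continuous g ->
  rint a b (fun t => f t - g t) = rint a b f - rint a b g.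
Proof. by move=> cf cg; apply: RintegralB => //; apply: integrable_itv. Qed.

Lemma rintZ a b f k : continuous f -> rint a b (fun t => k * f t) = k * rint a b f.
Proof. by move=> cf; apply: RintegralZl => //; apply: integrable_itv. Qed.

Lemma rint_split a b c f : continuous f -> a <= b -> b <= c ->
  rint a c f = rint a b f + rint b c f.
Proof.
move=> cf ab bc; have := @Rintegral_itvB R f (BLeft a) (BRight c) b.
move=> /(_ (integrable_itv _ _ cf)); rewrite !bnd_simp => /(_ ab bc).
(* The difference of the two integrals leaves a half-open interval; its missing endpoint is a null
   set. *)
rewrite Rintegral_itv_obnd_cbnd; last first.
  apply: integrableS (integrable_itv b c cf) => //.
  by apply: subset_itvr; rewrite bnd_simp.
by rewrite /rint => <-; rewrite addrC subrK.
Qed.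

Lemma rint_le a b f M : continuous f -> a <= b ->
  (forall t, a <= t <= b -> `|f t| <= M) -> `|rint a b f| <= M * (b - a).
Proof.
move=> cf ab fM; apply: (le_trans (le_normr_Rintegral _ (integrable_itv a b cf))) => //.
have -> : M * (b - a) = rint a b (fun=> M).
  rewrite /rint Rintegral_cst // (congr1 fine (lebesgue_measure_itv `[a, b])) /= lte_fin.
  by move: ab; rewrite le_eqVlt => /predU1P [->|->] //; rewrite ltxx subrr.
have cn : continuous (fun t => `|f t|).
  by move=> t; apply: cvg_norm; apply: cf.
apply: le_Rintegral => //; do ?exact: integrable_itv.
  by apply: integrable_itv; apply: cst_continuous.
Qed.

Lemma derive_continuous f (f' : R -> R) :
  (forall t : R, is_derive t 1 f (f' t)) -> continuous f.
Proof.
move=> df t; apply: differentiable_continuous; apply/derivable1_diffP.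
by case: (df t).
Qed.

Lemma rint_FTC a b f (f' : R -> R) : (forall t : R, is_derive t 1 f (f' t)) ->
  continuous f' -> a < b -> rint a b f' = f b - f a.
Proof.
move=> df cf' ab; have cf := derive_continuous df.
rewrite /rint /Rintegral (@continuous_FTC2 _ f' f) //.
- exact: continuous_subspaceT.
- split; first by move=> t _; case: (df t).
  + by apply: cvg_at_right_filter; apply: cf.
  + by apply: cvg_at_left_filter; apply: cf.
- by move=> t _; rewrite derive1E; apply: derive_val.
Qed.

End RealIntegral.

(** * Complex-valued integrands, by real and imaginary parts *)

Section ComplexIntegral.
Variable R : realType.
Local Notation C := R[i].
Local Notation Re := (@complex.Re R).
Local Notation Im := (@complex.Im R).
Local Notation normc := (@Normc.normc R).
Implicit Types (z w l : C) (g h : R -> C) (F : C -> C).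

Lemma norm_complexE z : `|z| = (normc z)%:C.
Proof. by case: z => x y; rewrite normc_def. Qed.

Lemma normc_add z w : normc (z + w) <= normc z + normc w.
Proof. exact: le_normcD. Qed.

Lemma normc_sub z w : normc (z - w) <= normc z + normc w.
Proof. by apply: le_trans (le_normcD _ _) _; rewrite normcN. Qed.

Lemma normc_distC z w : normc (z - w) = normc (w - z).
Proof. by rewrite -opprB normcN. Qed.

Lemma normc_ge0 z : 0 <= normc z.
Proof. by case: z => x y; apply: sqrtr_ge0. Qed.

Lemma normc_eq0 z : (normc z == 0) = (z == 0).
Proof.
apply/eqP/eqP => [|->]; [exact: Normc.eq0_normc|exact: Normc.normc0].
Qed.

Lemma normc_gt0 z : (0 < normc z) = (z != 0).
Proof. by rewrite lt_def normc_ge0 andbT normc_eq0. Qed.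

Lemma normc_mul z w : normc (z * w) = normc z * normc w.
Proof. exact: Normc.normcM. Qed.

Lemma normcX z k : normc (z ^+ k) = normc z ^+ k.
Proof.
elim: k => [|k IH]; first by rewrite !expr0 Normc.normc1.
by rewrite !exprS normc_mul IH.
Qed.

Lemma normc_real (x : R) : normc x%:C = `|x|.
Proof. by rewrite /Normc.normc /= expr0n /= addr0 sqrtr_sqr. Qed.

Lemma Re_le_normc z : `|Re z| <= normc z.
Proof. by rewrite -lecR -norm_complexE; apply: normc_ge_Re. Qed.

Lemma Im_le_normc z : `|Im z| <= normc z.
Proof.
case: z => x y /=; rewrite -(sqrtr_sqr y) ler_sqrt ?addr_ge0 ?sqr_ge0 //.
by rewrite lerDr sqr_ge0.
Qed.

Lemma normc_le_ReIm z : normc z <= `|Re z| + `|Im z|.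
Proof.
case: z => x y; have -> : x +i* y = x%:C + 'i%C * y%:C by simpc.
apply: le_trans (normc_add _ _) _; rewrite normc_mul !normc_real /= .
by rewrite /Normc.normc /= expr0n expr1n add0r sqrtr1 mul1r; simpc.
Qed.

Definition ccont g := continuous (Re \o g) /\ continuous (Im \o g).

(** Asked at every real [t], which avoids one-sided derivatives at the ends of an interval; the
    curves used below are accordingly defined on the whole line. *)
Definition cderiv g g' := forall t : R,
  is_derive t 1 (Re \o g) (Re (g' t)) /\ is_derive t 1 (Im \o g) (Im (g' t)).

Definition cint (a b : R) g : C := rint a b (Re \o g) +i* rint a b (Im \o g).

Lemma ReM z w : Re (z * w) = Re z * Re w - Im z * Im w.
Proof. by case: z w => [a b] [c d]. Qed.
Lemma ImM z w : Im (z * w) = Re z * Im w + Im z * Re w.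
Proof. by case: z w => [a b] [c d]. Qed.
Lemma ReD z w : Re (z + w) = Re z + Re w.
Proof. by case: z w => [a b] [c d]. Qed.
Lemma ImD z w : Im (z + w) = Im z + Im w.
Proof. by case: z w => [a b] [c d]. Qed.

Lemma ccont_cst z : ccont (fun=> z).
Proof. by split; apply: cst_continuous. Qed.

Lemma ccontD g h : ccont g -> ccont h -> ccont (fun t => g t + h t).
Proof.
move=> [g1 g2] [h1 h2]; split.
  rewrite (_ : _ \o _ = (Re \o g) + (Re \o h)); last first.
    by apply/funext => t /=; rewrite ReD.
  by move=> t; apply: cvgD; [apply: g1|apply: h1].
rewrite (_ : _ \o _ = (Im \o g) + (Im \o h)); last first.
  by apply/funext => t /=; rewrite ImD.
by move=> t; apply: cvgD; [apply: g2|apply: h2].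
Qed.

Lemma ccontM g h : ccont g -> ccont h -> ccont (fun t => g t * h t).
Proof.
move=> [g1 g2] [h1 h2]; split.
  rewrite (_ : _ \o _ = (Re \o g) * (Re \o h) - (Im \o g) * (Im \o h)); last first.
    by apply/funext => t /=; rewrite ReM.
  move=> t; apply: cvgB; apply: cvgM;
    [exact: g1|exact: h1|exact: g2|exact: h2].
rewrite (_ : _ \o _ = (Re \o g) * (Im \o h) + (Im \o g) * (Re \o h)); last first.
  by apply/funext => t /=; rewrite ImM.
move=> t; apply: cvgD; apply: cvgM;
  [exact: g1|exact: h2|exact: g2|exact: h1].
Qed.

Lemma ccontZ z g : ccont g -> ccont (fun t => z * g t).
Proof. by move=> cg; apply: ccontM => //; apply: ccont_cst. Qed.

Lemma ccontB g h : ccont g -> ccont h -> ccont (fun t => g t - h t).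
Proof.
move=> cg /(ccontZ (-1)) ch; have := ccontD cg ch.
by under eq_fun do rewrite mulN1r.
Qed.

Lemma ccontX g k : ccont g -> ccont (fun t => g t ^+ k).
Proof.
move=> cg; elim: k => [|k IH]; first by under eq_fun do rewrite expr0; apply: ccont_cst.
by under eq_fun do rewrite exprS; apply: ccontM.
Qed.

Lemma ccont_sum (I : Type) (s : seq I) (G : I -> R -> C) :
  (forall i, ccont (G i)) -> ccont (fun t => \sum_(i <- s) G i t).
Proof.
move=> cG; elim: s => [|i s IH].
  by under eq_fun do rewrite big_nil; apply: ccont_cst.
by under eq_fun do rewrite big_cons; apply: ccontD.
Qed.

Lemma cderiv_ccont g g' : cderiv g g' -> ccont g.
Proof.
by move=> dg; split; [apply: (@derive_continuous _ _ (Re \o g'))|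
  apply: (@derive_continuous _ _ (Im \o g'))] => t; case: (dg t).
Qed.

Lemma eq_cderiv g g' h h' : cderiv g g' -> g =1 h -> g' =1 h' -> cderiv h h'.
Proof. by move=> dg /funext <- /funext <-. Qed.

Lemma cderiv_cst z : cderiv (fun=> z) (fun=> 0).
Proof. by move=> t; split; apply: is_derive_cst. Qed.

Lemma cderivD g g' h h' : cderiv g g' -> cderiv h h' ->
  cderiv (fun t => g t + h t) (fun t => g' t + h' t).
Proof.
move=> dg dh t; have [g1 g2] := dg t; have [h1 h2] := dh t; split.
  rewrite (_ : _ \o _ = (Re \o g) + (Re \o h)) ?ReD; last first.
    by apply/funext => s /=; rewrite ReD.
  exact: is_deriveD.
rewrite (_ : _ \o _ = (Im \o g) + (Im \o h)) ?ImD; last first.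
  by apply/funext => s /=; rewrite ImD.
exact: is_deriveD.
Qed.

Lemma cderivM g g' h h' : cderiv g g' -> cderiv h h' ->
  cderiv (fun t => g t * h t) (fun t => g' t * h t + g t * h' t).
Proof.
move=> dg dh t; have [g1 g2] := dg t; have [h1 h2] := dh t; split.
  rewrite (_ : _ \o _ = (Re \o g) * (Re \o h) - (Im \o g) * (Im \o h)); last first.
    by apply/funext => s /=; rewrite ReM.
  apply: (is_derive_eq (is_deriveB (is_deriveM g1 h1) (is_deriveM g2 h2))).
  rewrite /GRing.scale /= ReD !ReM; ring.
rewrite (_ : _ \o _ = (Re \o g) * (Im \o h) + (Im \o g) * (Re \o h)); last first.
  by apply/funext => s /=; rewrite ImM.
apply: (is_derive_eq (is_deriveD (is_deriveM g1 h2) (is_deriveM g2 h1))).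
rewrite /GRing.scale /= ImD !ImM; ring.
Qed.

Lemma cderivZ z g g' : cderiv g g' -> cderiv (fun t => z * g t) (fun t => z * g' t).
Proof.
move=> dg; apply: (eq_cderiv (cderivM (cderiv_cst z) dg)) => // t.
by rewrite mul0r add0r.
Qed.

Lemma cderivX g g' k : cderiv g g' ->
  cderiv (fun t => g t ^+ k) (fun t => k%:R * g t ^+ k.-1 * g' t).
Proof.
move=> dg; elim: k => [|k IH].
  by apply: (eq_cderiv (cderiv_cst 1)) => t; rewrite ?expr0 // !mul0r.
apply: (eq_cderiv (cderivM dg IH)) => t /=; first by rewrite exprS.
case: k {IH} => [|k] /=; first by rewrite expr0; ring.
by rewrite exprS -[k.+2]addn1 -[k.+1]addn1 !natrD; ring.
Qed.

Lemma eq_cint a b g h : g =1 h -> cint a b g = cint a b h.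
Proof. by move=> /funext ->. Qed.

Lemma cintD a b g h : ccont g -> ccont h ->
  cint a b (fun t => g t + h t) = cint a b g + cint a b h.
Proof.
move=> [g1 g2] [h1 h2]; rewrite /cint -[RHS]/(_ +i* _) -!rintD //.
by congr (_ +i* _); congr rint; apply/funext => t /=; rewrite (ReD, ImD).
Qed.

Lemma cintZ a b z g : ccont g -> cint a b (fun t => z * g t) = z * cint a b g.
Proof.
move=> [g1 g2]; rewrite /cint; case: z => x y; rewrite -[RHS]/(_ +i* _).
have cZ k (f : R -> R) : continuous f -> continuous (fun t => k * f t).
  by move=> cf t; apply: cvgM; [apply: cvg_cst|apply: cf].
rewrite -!rintZ // -rintB -?rintD; try exact: cZ.
by congr (_ +i* _); congr rint; apply/funext => t /=; rewrite (ReM, ImM).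
Qed.

Lemma cintB a b g h : ccont g -> ccont h ->
  cint a b (fun t => g t - h t) = cint a b g - cint a b h.
Proof.
move=> cg ch; rewrite -mulN1r -cintZ // -cintD //; last exact: ccontZ.
by apply: eq_cint => t; rewrite mulN1r.
Qed.

Lemma cint0 a b : cint a b (fun=> 0) = 0.
Proof.
by rewrite -[RHS](mul0r (cint a b (fun=> 0))) -cintZ ?mul0r //; apply: ccont_cst.
Qed.

Lemma cint_sum a b (I : Type) (s : seq I) (G : I -> R -> C) :
  (forall i, ccont (G i)) ->
  cint a b (fun t => \sum_(i <- s) G i t) = \sum_(i <- s) cint a b (G i).
Proof.
move=> cG; elim: s => [|i s IH].
  by rewrite big_nil -[RHS](cint0 a b); apply: eq_cint => t; rewrite big_nil.
rewrite big_cons -IH -cintD //; last exact: ccont_sum.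
by apply: eq_cint => t; rewrite big_cons.
Qed.

Lemma cint_split a b c g : ccont g -> a <= b -> b <= c ->
  cint a c g = cint a b g + cint b c g.
Proof.
by move=> [g1 g2] ab bc; rewrite /cint (rint_split g1 ab bc) (rint_split g2 ab bc).
Qed.

(** The factor 2 comes from bounding the real and imaginary parts separately; it is harmless, since
    the bounds below only have to become small. *)
Lemma cint_le a b g (M : R) : ccont g -> a <= b ->
  (forall t, a <= t <= b -> normc (g t) <= M) -> normc (cint a b g) <= 2 * M * (b - a).
Proof.
move=> [g1 g2] ab gM; apply: le_trans (normc_le_ReIm _) _ => /=.
have -> : 2 * M * (b - a) = M * (b - a) + M * (b - a) by ring.
apply: lerD; apply: rint_le => // t /gM; apply: le_trans.
  exact: Re_le_normc.
exact: Im_le_normc.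
Qed.

Lemma cint_FTC a b g g' : cderiv g g' -> ccont g' -> a < b ->
  cint a b g' = g b - g a.
Proof.
move=> dg [c1 c2] ab.
have e1 : rint a b (Re \o g') = Re (g b) - Re (g a).
  by apply: (rint_FTC (f := Re \o g)) => // t; case: (dg t).
have e2 : rint a b (Im \o g') = Im (g b) - Im (g a).
  by apply: (rint_FTC (f := Im \o g)) => // t; case: (dg t).
by rewrite /cint e1 e2; case: (g a) (g b) => [? ?] [].
Qed.

End ComplexIntegral.

(** * Complex differentiability and bisection *)

Lemma derivable_diff_quotient (K : numFieldType) (f : K -> K) (u z : K) :
  z != u -> derivable f z 1 ->
  derivable (fun w => (f w - f u) * (w - u)^-1) z 1.
Proof.
move=> zu df; apply: derivableM.
  by apply: derivableB => //; apply: derivable_cst.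
apply: derivableV; first by rewrite subr_eq0.
apply: derivableB; [exact: derivable_id|exact: derivable_cst].
Qed.

Section ComplexDerivative.
Variable R : realType.
Local Notation C := R[i].
Local Notation Re := (@complex.Re R).
Local Notation Im := (@complex.Im R).
Local Notation normc := (@Normc.normc R).
Local Notation K := (R[i] : numFieldType).
Implicit Types (z w l : C) (g h : R -> C) (F : C -> C).

(** The form without division allows [w = z], and [normc] keeps all estimates in the real field,
    whereas the norm of [R[i]] has complex values. *)
Definition cdiff F z l := forall e : R, 0 < e -> exists2 d : R, 0 < d &
  forall w, normc (w - z) < d -> normc (F w - F z - l * (w - z)) <= e * normc (w - z).

Lemma gt0_real_complex (e : C) : 0 < e -> exists2 x : R, 0 < x & e = x%:C.
Proof.
case: e => x y; rewrite ltcE /= => /andP [/eqP -> x0].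
by exists x.
Qed.

Lemma derivable_cdiff F z : derivable (F : K -> K) z 1 -> exists l, cdiff F z l.
Proof.
move=> /cvg_ex [l hl]; exists l => e e0.
have e0' : 0 < e%:C by rewrite ltcR.
move/cvgrPdist_le : hl => /(_ _ e0') [d' /gt0_real_complex [d d0 ->] H].
exists d => // w; have [->|wz] := eqVneq w z.
  by rewrite !subrr mulr0 subr0 Normc.normc0 mulr0.
move=> wd; have wz0 : w - z != 0 by rewrite subr_eq0.
have {}H : normc (l - (w - z)^-1 * (F ((w - z) * 1 + z) - F z)) <= e.
  have hd : `|0 - (w - z)| < d%:C.
    by have := norm_complexE (0 - (w - z)) => ->; rewrite ltcR sub0r normcN.
  have := H (w - z) hd wz0; rewrite -lecR => {}H.
  by have := norm_complexE (l - (w - z)^-1 * (F ((w - z) * 1 + z) - F z)) => <-.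
move: H; rewrite mulr1 subrK => H.
have -> : F w - F z - l * (w - z) = - ((l - (w - z)^-1 * (F w - F z)) * (w - z)).
  by rewrite mulrBl mulrAC mulVf // mul1r opprB.
by rewrite normcN normc_mul ler_wpM2r // normc_ge0.
Qed.

Lemma cdiff_derive1 F z l : cdiff F z l -> derive1 (F : K -> K) z = l.
Proof.
move=> dF; apply: cvg_lim => //.
apply/cvgrPdist_le => e' /gt0_real_complex [e e0 ->].
have [d d0 H] := dF e e0.
exists d%:C; first by rewrite /= ltcR.
move=> h; rewrite /= /ball /= => hd' h0.
have hd : normc h < d.
  have := hd' : `|0 - h| < d%:C; have := norm_complexE (0 - h) => ->.
  by rewrite ltcR sub0r normcN.
suff : normc (l - h^-1 * (F (h + z) - F z)) <= e.
  by rewrite -lecR; have := norm_complexE (l - h^-1 * (F (h + z) - F z)) => <-.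
have := H (h + z); rewrite addrK => /(_ hd) {H} H.
have -> : l - h^-1 * (F (h + z) - F z) = - ((F (h + z) - F z - l * h) * h^-1).
  by rewrite mulrBl mulfK // opprB [X in _ - X]mulrC.
rewrite normcN normc_mul Normc.normcV ler_pdivrMr ?normc_gt0 //.
Qed.

Lemma cdiff_lipschitz F z l : cdiff F z l -> exists2 d : R, 0 < d &
  forall w, normc (w - z) < d -> normc (F w - F z) <= (1 + normc l) * normc (w - z).
Proof.
move=> /(_ 1 ltr01) [d d0 H]; exists d => // w /H h.
have -> : F w - F z = (F w - F z - l * (w - z)) + l * (w - z) by rewrite subrK.
by apply: le_trans (normc_add _ _) _; rewrite mulrDl lerD // normc_mul.
Qed.

Lemma ccontP g : ccont g <-> forall t (e : R), 0 < e ->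
  exists2 d : R, 0 < d & forall s, `|s - t| < d -> normc (g s - g t) < e.
Proof.
split=> [[c1 c2] t e e0|H].
  have e2 : 0 < e / 2 by lra.
  have [d1 /= d10 H1] := (cvgrPdist_lt _ _).1 (c1 t) _ e2.
  have [d2 /= d20 H2] := (cvgrPdist_lt _ _).1 (c2 t) _ e2.
  exists (Num.min d1 d2); first by rewrite lt_min d10.
  move=> s; rewrite lt_min => /andP [s1 s2].
  rewrite normc_distC; apply: le_lt_trans (normc_le_ReIm _) _.
  rewrite [e]splitr; have := H1 s; have := H2 s.
  rewrite /ball /= !(distrC t s) => /(_ s2) h2 /(_ s1) h1.
  by apply: ltrD; move: h1 h2; case: (g t) (g s) => [? ?] [].
split=> t; apply/cvgrPdist_lt => e /(H t) [d d0 {}H];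
  exists d => // s; rewrite /ball /= distrC => /H; rewrite normc_distC;
  apply: le_lt_trans.
  by apply: le_trans (Re_le_normc _); case: (g t) (g s) => [? ?] [].
by apply: le_trans (Im_le_normc _); case: (g t) (g s) => [? ?] [].
Qed.

Lemma ccont_comp F g : ccont g -> (forall t, exists l, cdiff F (g t) l) ->
  ccont (fun t => F (g t)).
Proof.
move=> /ccontP cg dF; apply/ccontP => t e e0.
have [l /cdiff_lipschitz [d d0 H]] := dF t.
have l0 : 0 < 1 + normc l by rewrite ltr_pwDl // normc_ge0.
have m0 : 0 < Num.min d (e / (1 + normc l)) by rewrite lt_min d0 divr_gt0.
have [d' d'0 H'] := cg t _ m0; exists d' => // s /H'.
rewrite lt_min => /andP [s1 s2]; apply: le_lt_trans (H _ s1) _.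
by move: s2; rewrite ltr_pdivlMr // mulrC.
Qed.

End ComplexDerivative.

Section Goursat.
Variable R : realType.
Local Notation C := R[i].
Local Notation normc := (@Normc.normc R).

(** Every left end lies below every right end, so the supremum of the left ends belongs to all
    segments. *)
Lemma nested_segments (x s : nat -> R) :
    (forall n, x n <= x n.+1) -> (forall n, x n.+1 + s n.+1 <= x n + s n) ->
    (forall n, 0 <= s n) ->
  exists y, forall n, x n <= y <= x n + s n.
Proof.
move=> xS sS s0.
have xm n m : (n <= m)%N -> x n <= x m.
  elim: m => [|m IH]; first by rewrite leqn0 => /eqP ->.
  by rewrite leq_eqVlt => /predU1P [->|] // /IH /le_trans; apply.
have sm n m : (n <= m)%N -> x m + s m <= x n + s n.
  elim: m => [|m IH]; first by rewrite leqn0 => /eqP ->.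
  rewrite leq_eqVlt => /predU1P [->|] // /IH; apply: le_trans.
  exact: sS.
have ub n m : x m <= x n + s n.
  case: (leqP n m) => [nm|/ltnW mn]; last first.
    by apply: le_trans (xm _ _ mn) _; rewrite lerDl.
  by apply: le_trans (sm _ _ nm); rewrite lerDl.
exists (sup (range x)) => n; apply/andP; split.
  apply: ub_le_sup; last by exists n.
  by exists (x 0%N + s 0%N) => _ [m _ <-].
apply: ge_sup; first by exists (x 0%N), 0%N.
by move=> _ [m _ <-].
Qed.

(** A square where [P] fails has a quarter where it fails. Iterating gives squares that shrink to a
    point, and near that point the local hypothesis gives [P]. *)
Lemma square_bisection (P : R -> R -> R -> Prop) (a c s : R) :
    0 < s ->
    (forall x y s, 0 < s -> P x y s -> P (x + s) y s -> P x (y + s) s ->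
      P (x + s) (y + s) s -> P x y (2 * s)) ->
    (forall x y, exists2 d : R, 0 < d & forall x' y' s', 0 < s' < d ->
      x' <= x <= x' + s' -> y' <= y <= y' + s' -> P x' y' s') ->
  P a c s.
Proof.
move=> s0 Pq Ploc; apply: contrapT => nP.
pose T := (R * R * R)%type.
(* The conditions on [q] sit inside the existential, so that choice yields a total function [next]
   that can be iterated. *)
have step (q : T) : exists q' : T, 0 < q.2 -> ~ P q.1.1 q.1.2 q.2 ->
    [/\ q'.2 = q.2 / 2, ~ P q'.1.1 q'.1.2 q'.2,
        q.1.1 <= q'.1.1 <= q.1.1 + q.2 / 2 & q.1.2 <= q'.1.2 <= q.1.2 + q.2 / 2].
  case: q => [[x y] t] /=; have [t0|] := ltP 0 t; last by exists (x, y, t).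
  have [Pt|nPt] := pselect (P x y t); first by exists (x, y, t).
  have th : 0 < t / 2 by lra.
  have e : t = 2 * (t / 2) by lra.
  have [P1|n1] := pselect (P x y (t / 2)); last first.
    by exists (x, y, t / 2) => _ _; split => //=; lra.
  have [P2|n2] := pselect (P (x + t / 2) y (t / 2)); last first.
    by exists (x + t / 2, y, t / 2) => _ _; split => //=; lra.
  have [P3|n3] := pselect (P x (y + t / 2) (t / 2)); last first.
    by exists (x, y + t / 2, t / 2) => _ _; split => //=; lra.
  exists (x + t / 2, y + t / 2, t / 2) => _ _; split => //=; try lra.
  by move=> P4; apply: nPt; rewrite e; apply: Pq.
have [next nextP] := choice step.
pose q n := iter n next (a, c, s).
have qP n : (q n).2 = s / 2 ^+ n /\ ~ P (q n).1.1 (q n).1.2 (q n).2.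
  elim: n => [|n [IH1 IH2]]; first by rewrite expr0 divr1.
  have q0 : 0 < (q n).2 by rewrite IH1 divr_gt0 // exprn_gt0.
  have [h1 h2 _ _] := nextP (q n) q0 IH2; split => //.
  by rewrite [LHS]h1 IH1 exprSr invfM mulrA.
have q0 n : 0 < (q n).2 by rewrite (qP n).1 divr_gt0 // exprn_gt0.
have qS n := nextP (q n) (q0 n) (qP n).2.
have [x hx] : exists x, forall n, (q n).1.1 <= x <= (q n).1.1 + (q n).2.
  apply: nested_segments => n; last exact: ltW.
    by have [_ _ ? _] := qS n; rewrite [q n.+1]/=; lra.
  by have [e _ ? _] := qS n; rewrite [q n.+1]/= e; have := q0 n; lra.
have [y hy] : exists y, forall n, (q n).1.2 <= y <= (q n).1.2 + (q n).2.
  apply: nested_segments => n; last exact: ltW.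
    by have [_ _ _ ?] := qS n; rewrite [q n.+1]/=; lra.
  by have [e _ _ ?] := qS n; rewrite [q n.+1]/= e; have := q0 n; lra.
have [d d0 H] := Ploc x y.
have sd : 0 <= s / d by rewrite divr_ge0 // ltW.
pose n := Num.Def.archi_bound (s / d).
have nd : s / d < 2 ^+ n.
  apply: lt_le_trans (archi_boundP sd) _; rewrite -natrX ler_nat.
  by rewrite ltnW // ltn_expl.
apply: (qP n).2; apply: H => //; rewrite q0 (qP n).1.
by rewrite ltr_pdivrMr ?exprn_gt0 // mulrC -ltr_pdivrMr.
Qed.

End Goursat.

(** * Goursat's theorem *)

Section Edge.
Variable R : realType.
Local Notation C := R[i].
Local Notation normc := (@Normc.normc R).
Implicit Types (g : R -> C) (F : C -> C).

Lemma cderiv_increment g g' (M a b : R) : cderiv g g' -> ccont g' ->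
  (forall t, normc (g' t) <= M) -> a <= b -> normc (g b - g a) <= 2 * M * (b - a).
Proof.
move=> dg cg' gM; rewrite le_eqVlt => /predU1P [->|ab].
  by rewrite !subrr mulr0 Normc.normc0.
rewrite -(cint_FTC dg cg' ab); apply: cint_le => //; exact: ltW.
Qed.

(* A primitive of [w |-> c + l (w - z0)]. *)
Definition affine_primitive (z0 c l w : C) : C := c * w + l / 2 * (w - z0) ^+ 2.

Lemma edge_estimate F g g' (z0 l : C) (M e a b : R) :
    cderiv g g' -> ccont g' -> ccont (fun t => F (g t)) -> a < b ->
    (forall t, normc (g' t) <= M) ->
    (forall t, a <= t <= b -> normc (F (g t) - F z0 - l * (g t - z0)) <= e) ->
  normc (cint a b (fun t => F (g t) * g' t) -
    (affine_primitive z0 (F z0) l (g b) - affine_primitive z0 (F z0) l (g a)))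
  <= 2 * (e * M) * (b - a).
Proof.
move=> dg cg' cF ab gM Fe; set P := affine_primitive z0 (F z0) l.
have cg := cderiv_ccont dg.
pose lin t := F z0 + l * (g t - z0).
have dP : cderiv (fun t => P (g t)) (fun t => lin t * g' t).
  have dgz : cderiv (fun t => g t - z0) g'.
    by apply: (eq_cderiv (cderivD dg (cderiv_cst (- z0)))) => // t; rewrite addr0.
  apply: (eq_cderiv (cderivD (cderivZ (F z0) dg)
    (cderivZ (l / 2) (cderivX 2 dgz)))) => // t.
  by rewrite /lin /=; field.
have clin : ccont lin.
  by apply: ccontD; [apply: ccont_cst|apply/ccontZ/ccontB => //; apply: ccont_cst].
rewrite -(cint_FTC dP _ ab); last exact: ccontM.
rewrite -cintB; try exact: ccontM.
apply: cint_le => [||t tab]; last first.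
- have -> : F (g t) * g' t - lin t * g' t = (F (g t) - F z0 - l * (g t - z0)) * g' t.
    by rewrite /lin; ring.
  by rewrite Normc.normcM ler_pM ?normc_ge0 // Fe.
- exact: ltW.
- by apply: ccontB; apply: ccontM.
Qed.

End Edge.

Section Goursat.
Variable R : realType.
Local Notation C := R[i].
Local Notation normc := (@Normc.normc R).
Variables (F : C -> C) (z zx zt : R -> R -> C) (M : R).
Hypothesis M_gt0 : 0 < M.
Hypothesis zx_deriv : forall t, cderiv (z ^~ t) (zx ^~ t).
Hypothesis zt_deriv : forall x, cderiv (z x) (zt x).
Hypothesis zx_cont : forall t, ccont (zx ^~ t).
Hypothesis zt_cont : forall x, ccont (zt x).
Hypothesis zx_le : forall x t, normc (zx x t) <= M.
Hypothesis zt_le : forall x t, normc (zt x t) <= M.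
Hypothesis F_diff : forall x t, exists l, cdiff F (z x t) l.

(** The form F dz pulled back to an edge of a parameter square. Goursat's argument subdivides the
    parameter square, not its curved image. *)
Definition hedge (c a s : R) : C := cint a (a + s) (fun x => F (z x c) * zx x c).
Definition vedge (a c s : R) : C := cint c (c + s) (fun t => F (z a t) * zt a t).
Definition boundary_integral (a c s : R) : C :=
  hedge c a s + vedge (a + s) c s - hedge (c + s) a s - vedge a c s.

Let hF t : ccont (fun x => F (z x t)).
Proof. by apply: ccont_comp => //; apply: cderiv_ccont (zx_deriv t). Qed.

Let vF x : ccont (fun t => F (z x t)).
Proof. by apply: ccont_comp => //; apply: cderiv_ccont (zt_deriv x). Qed.

Lemma hedge_split c a s : 0 < s -> hedge c a (2 * s) = hedge c a s + hedge c (a + s) s.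
Proof.
move=> s0; rewrite /hedge (@cint_split _ _ (a + s)) ?lerDl ?(ltW s0) //.
- by congr (_ + cint _ _ _); ring.
- exact: ccontM.
- by rewrite mulr_natl mulr2n addrA lerDl ltW.
Qed.

Lemma vedge_split c a s : 0 < s -> vedge c a (2 * s) = vedge c a s + vedge c (a + s) s.
Proof.
move=> s0; rewrite /vedge (@cint_split _ _ (a + s)) ?lerDl ?(ltW s0) //.
- by congr (_ + cint _ _ _); ring.
- exact: ccontM.
- by rewrite mulr_natl mulr2n addrA lerDl ltW.
Qed.

(** Each inner edge borders two quarters and is run through in opposite directions. *)
Lemma boundary_integral_split a c s : 0 < s ->
  boundary_integral a c (2 * s) =
  boundary_integral a c s + boundary_integral (a + s) c s +
  boundary_integral a (c + s) s + boundary_integral (a + s) (c + s) s.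
Proof.
move=> s0; rewrite /boundary_integral !hedge_split // !vedge_split //.
have -> : a + 2 * s = a + s + s by ring.
have -> : c + 2 * s = c + s + s by ring.
ring.
Qed.

Lemma z_increment x t x' t' s : 0 <= s -> `|x' - x| <= s -> `|t' - t| <= s ->
  normc (z x' t' - z x t) <= 4 * M * s.
Proof.
move=> s0 xs ts.
have inc (g g' : R -> C) (a b : R) : cderiv g g' -> ccont g' ->
    (forall r, normc (g' r) <= M) -> `|b - a| <= s -> normc (g b - g a) <= 2 * M * s.
  move=> dg cg gM; case: (leP a b) => [ab|/ltW ba] bs.
    apply: le_trans (cderiv_increment dg cg gM ab) _.
    by rewrite ler_wpM2l ?mulr_ge0 ?(ltW M_gt0) // (le_trans (ler_norm _)).
  rewrite normc_distC; apply: le_trans (cderiv_increment dg cg gM ba) _.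
  rewrite ler_wpM2l ?mulr_ge0 ?(ltW M_gt0) // (le_trans (ler_norm _)) //.
  by rewrite distrC.
have -> : z x' t' - z x t = (z x' t' - z x t') + (z x t' - z x t) by ring.
apply: le_trans (normc_add _ _) _.
have -> : 4 * M * s = 2 * M * s + 2 * M * s by ring.
apply: lerD; first exact: (inc (z ^~ t') (zx ^~ t')).
exact: (inc (z x) (zt x)).
Qed.

(** Around the boundary the end values of the affine primitive cancel, so only the four edge
    remainders count. *)
Lemma boundary_integral_small (e x t : R) : 0 < e -> exists2 d : R, 0 < d &
  forall a c s, 0 < s < d -> a <= x <= a + s -> c <= t <= c + s ->
  normc (boundary_integral a c s) <= e * s ^+ 2.
Proof.
move=> e0; have [l dF] := F_diff x t.
(* Each edge contributes [E], which is 8 eta M^2 s^2; four edges give 32 eta M^2 s^2, to equal e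
   s^2. *)
pose eta := e / (32 * M ^+ 2).
have eta0 : 0 < eta by rewrite divr_gt0 // mulr_gt0 // exprn_gt0.
have [d d0 H] := dF eta eta0.
(* On a square of side [s] the map [z] varies by at most 4 M s, which then stays below [d]. *)
exists (d / (4 * M)); first by rewrite divr_gt0 // mulr_gt0.
move=> a c s /andP [s0 sd] xas tcs.
have F_lin x' t' : a <= x' <= a + s -> c <= t' <= c + s ->
    normc (F (z x' t') - F (z x t) - l * (z x' t' - z x t)) <= eta * (4 * M * s).
  move=> hx ht; have zs : normc (z x' t' - z x t) <= 4 * M * s.
    by apply: z_increment; rewrite ?ler_norml; lra.
  apply: le_trans (H _ _) _; last by rewrite ler_pM2l.
  by apply: le_lt_trans zs _; rewrite mulrC -ltr_pdivlMr // mulr_gt0.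
pose P := affine_primitive (z x t) (F (z x t)) l.
pose E := 2 * (eta * (4 * M * s) * M) * s.
have hE c' : c <= c' <= c + s ->
    normc (hedge c' a s - (P (z (a + s) c') - P (z a c'))) <= E.
  move=> hc; have := @edge_estimate R F (z ^~ c') (zx ^~ c') (z x t) l M
    (eta * (4 * M * s)) a (a + s).
  by rewrite [a + s - a]addrC addKr; apply; rewrite ?ltrDl // => x' hx; apply: F_lin.
have vE a' : a <= a' <= a + s ->
    normc (vedge a' c s - (P (z a' (c + s)) - P (z a' c))) <= E.
  move=> ha; have := @edge_estimate R F (z a') (zt a') (z x t) l M
    (eta * (4 * M * s)) c (c + s).
  by rewrite [c + s - c]addrC addKr; apply; rewrite ?ltrDl // => x' hx; apply: F_lin.
have -> : boundary_integral a c s =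
    (hedge c a s - (P (z (a + s) c) - P (z a c)))
  + (vedge (a + s) c s - (P (z (a + s) (c + s)) - P (z (a + s) c)))
  - (hedge (c + s) a s - (P (z (a + s) (c + s)) - P (z a (c + s))))
  - (vedge a c s - (P (z a (c + s)) - P (z a c))).
  by rewrite /boundary_integral; ring.
have -> : e * s ^+ 2 = E + E + E + E.
  by rewrite /E /eta; field; rewrite lt0r_neq0.
apply: le_trans (normc_sub _ _) _; apply: lerD; last by apply: vE; lra.
apply: le_trans (normc_sub _ _) _; apply: lerD; last by apply: hE; lra.
apply: le_trans (normc_add _ _) _; apply: lerD; last by apply: vE; lra.
by apply: hE; lra.
Qed.

(** A bound by [k] times the area adds up correctly over four quarters and holds locally for every
    [k > 0]; bisection makes it global, and [k] is arbitrary. *)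
Theorem goursat a c s : 0 < s -> boundary_integral a c s = 0.
Proof.
move=> s0; apply/eqP; rewrite -normc_eq0; apply/eqP/le_anti.
rewrite normc_ge0 andbT; apply/ler_addgt0Pr => e e0; rewrite add0r.
have e0' : 0 < e / s ^+ 2 by rewrite divr_gt0 // exprn_gt0.
have : normc (boundary_integral a c s) <= e / s ^+ 2 * s ^+ 2; last first.
  by rewrite mulfVK // expf_neq0 // lt0r_neq0.
move: (e / _) e0' => k k0.
apply: (@square_bisection R (fun a c s =>
  normc (boundary_integral a c s) <= k * s ^+ 2)) => //.
  move=> x y r r0 h1 h2 h3 h4; rewrite boundary_integral_split //.
  have -> : k * (2 * r) ^+ 2 = k * r ^+ 2 + k * r ^+ 2 + k * r ^+ 2 + k * r ^+ 2 by ring.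
  do 3 (apply: le_trans (normc_add _ _) _; apply: lerD => //).
by move=> x y; apply: boundary_integral_small.
Qed.

End Goursat.

(** * Shrinking the circle to a point *)

Section Circle.
Variable R : realType.
Local Notation C := R[i].
Local Notation normc := (@Normc.normc R).
Local Notation K := (R[i] : numFieldType).

Lemma normc_circle (r t : R) : 0 <= r -> normc (circle r t) = r.
Proof.
move=> r0; rewrite /circle /Normc.normc !exprMn -mulrDr cos2Dsin2 mulr1.
by rewrite sqrtr_sqr ger0_norm.
Qed.

Lemma circle_2pi (r : R) : circle r (2 * pi) = circle r 0.
Proof. by rewrite /circle mulr_natl cos2pi sin2pi cos0 sin0. Qed.

Lemma circle_deriv (r : R) : cderiv (circle r) (fun t => 'i%C * circle r t).
Proof.
move=> t; split.
  rewrite (_ : _ \o _ = r *: cos); last by apply/funext.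
  apply: (is_derive_eq (is_deriveZ _ (is_derive_cos t))).
  by rewrite /GRing.scale /= mul0r sub0r mul1r mulrN.
rewrite (_ : _ \o _ = r *: sin); last by apply/funext.
apply: (is_derive_eq (is_deriveZ _ (is_derive_sin t))).
by rewrite /GRing.scale /= mul0r add0r mul1r.
Qed.

Lemma circle_cont (r : R) : ccont (circle r).
Proof. exact: cderiv_ccont (circle_deriv r). Qed.

Lemma cdiff_inv (z : C) : z != 0 -> exists l, cdiff (fun w => w^-1) z l.
Proof.
move=> z0; apply: derivable_cdiff.
by apply: derivableV => //; apply: derivable_id.
Qed.

Lemma ccontV (g : R -> C) : ccont g -> (forall t, g t != 0) -> ccont (fun t => (g t)^-1).
Proof.
by move=> cg g0; apply: (ccont_comp (F := fun w => w^-1)) => // t; apply: cdiff_inv.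
Qed.

Lemma ccont_bounded (a b : R) (g : R -> C) : a <= b -> ccont g ->
  exists2 B : R, 0 < B & forall t, a <= t <= b -> normc (g t) <= B.
Proof.
move=> ab [g1 g2].
have c : continuous (fun t => `|complex.Re (g t)| + `|complex.Im (g t)|).
  by move=> t; apply: cvgD; apply: cvg_norm; [apply: g1|apply: g2].
have [x _ H] := EVT_max ab (continuous_subspaceT c).
exists (1 + (`|complex.Re (g x)| + `|complex.Im (g x)|)).
  by rewrite ltr_pwDl // addr_ge0.
move=> t tab; apply: le_trans (normc_le_ReIm _) _.
by apply: le_trans (H t _) _; rewrite ?in_itv // lerDr.
Qed.

End Circle.

(** * The homotopy and the difference quotient *)

Section Homotopy.
Variable R : realType.
Local Notation C := R[i].
Local Notation normc := (@Normc.normc R).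
Local Notation K := (R[i] : numFieldType).
Variables (r : R) (u : C).
Hypothesis (r_gt0 : 0 < r) (r_lt1 : r < 1) (u_lt : normc u < r).

(** The factor s of the homotopy: 1 at [x = 0], small at [x = 2 * pi] when [k] is large, smooth on
    the line with values in ]0, 1]. Hence the homotopy stays in the disc, never meets [u], and has
    bounded partial derivatives, as [goursat] demands. *)
Definition shrink (k x : R) : R := (1 + (k * x) ^+ 2)^-1.
Definition shrink' (k x : R) : R := - (2 * k ^+ 2 * x) * shrink k x ^+ 2.

Let den_gt0 (k x : R) : 0 < 1 + (k * x) ^+ 2.
Proof. by rewrite ltr_pwDl // sqr_ge0. Qed.

Lemma shrink_gt0 k x : 0 < shrink k x.
Proof. by rewrite invr_gt0. Qed.

Lemma shrink_le1 k x : shrink k x <= 1.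
Proof. by rewrite invf_le1 // lerDl sqr_ge0. Qed.

(** With y = |k x| the claim becomes 2 y <= (1 + y^2)^2, which follows from 2 y <= 1 + y^2. *)
Lemma shrink'_le k x : 0 < k -> `|shrink' k x| <= k.
Proof.
move=> k0; rewrite /shrink' /shrink normrM normrN (ger0_norm (sqr_ge0 _)).
rewrite exprVn ler_pdivrMr ?exprn_gt0 //.
have -> : `|2 * k ^+ 2 * x| = k * (2 * `|k * x|).
  by rewrite !normrM (gtr0_norm k0) normr_nat; ring.
rewrite ler_pM2l // -(real_normK (num_real (k * x))).
have : 0 <= (1 - `|k * x|) ^+ 2 by apply: sqr_ge0.
move: `|k * x| (normr_ge0 (k * x)) => y y0; nra.
Qed.

Lemma shrink_deriv k (x : R) : is_derive x 1 (shrink k) (shrink' k x).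
Proof.
have h : is_derive x 1 (fun y : R => 1 + (k * y) ^+ 2) (2 * k ^+ 2 * x).
  apply: is_derive_eq; rewrite /GRing.scale /=; ring.
apply: (is_derive_eq (is_deriveV _ h)); first by rewrite lt0r_neq0.
by rewrite /shrink' /shrink /GRing.scale /= exprVn; ring.
Qed.

Lemma real_deriv (g g' : R -> R) : (forall t : R, is_derive t 1 g (g' t)) ->
  cderiv (fun t => (g t)%:C) (fun t => (g' t)%:C).
Proof. by move=> dg t; split; [exact: dg|apply: is_derive_cst]. Qed.

Let W (t : R) : C := circle r t - u.

Lemma circle_neq t : circle r t - u != 0.
Proof.
rewrite subr_eq0; apply/eqP => e; move: u_lt.
by rewrite -e normc_circle ?ltxx // ltW.
Qed.

Let W_le t : normc (W t) <= 2.
Proof.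
apply: le_trans (normc_sub _ _) _; rewrite normc_circle ?ltW //.
have := u_lt; have := r_lt1; lra.
Qed.

Definition homotopy (k x t : R) : C := u + (shrink k x)%:C * (circle r t - u).

Lemma homotopy_lt1 k x t : normc (homotopy k x t) < 1.
Proof.
have -> : homotopy k x t = (1 - shrink k x)%:C * u + (shrink k x)%:C * circle r t.
  by rewrite /homotopy rmorphB /=; ring.
apply: le_lt_trans (normc_add _ _) _.
rewrite !Normc.normcM !normc_real (gtr0_norm (shrink_gt0 _ _)).
rewrite ger0_norm ?subr_ge0 ?shrink_le1 // normc_circle ?(ltW r_gt0) //.
have := shrink_gt0 k x; have := shrink_le1 k x.
move: (shrink k x) => s s1 s0; have := u_lt; have := r_lt1; have := normc_ge0 u; nra.
Qed.

Lemma homotopy_neq k x t : homotopy k x t != u.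
Proof.
rewrite /homotopy -subr_eq0 addrAC subrr add0r mulf_neq0 ?circle_neq //.
by rewrite -normc_eq0 normc_real normr_eq0 lt0r_neq0 // shrink_gt0.
Qed.

(* Goursat's theorem on the homotopy [u + s (r e^(it) - u)] that shrinks the
   circle to its interior point [u]; the radial edges cancel by periodicity. *)
Lemma shrink_circle_integral (F : C -> C) k : 0 < k ->
    (forall w, w != u -> normc w < 1 -> exists l, cdiff F w l) ->
  circle_integral r F = cint 0 (2 * pi) (fun t =>
    F (homotopy k (2 * pi) t) * ((shrink k (2 * pi))%:C * ('i%C * circle r t))).
Proof.
move=> k0 dF.
pose zx x t : C := (shrink' k x)%:C * W t.
pose zt x t : C := (shrink k x)%:C * ('i%C * circle r t).
have dW : cderiv W (fun t => 'i%C * circle r t).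
  apply: (eq_cderiv (cderivD (circle_deriv r) (cderiv_cst (- u)))) => // t.
  by rewrite addr0.
have cs : ccont (fun x => (shrink k x)%:C).
  exact: cderiv_ccont (real_deriv (shrink_deriv k)).
(* The bound [2 * k + 1] dominates both partial derivatives: |shrink'| <= k times |W| <= 2 in [x],
   and at most r < 1 in [t]. *)
have := @goursat R F (homotopy k) zx zt (2 * k + 1).
(* The angle runs over [0, 2 pi] and the parameter domain is a square, so the homotopy variable runs
   over [0, 2 pi] too and ends at [shrink k (2 * pi)]. *)
move=> /(_ _ _ _ _ _ _ _ _ 0 0 (2 * pi)) H.
have : boundary_integral F (homotopy k) zx zt 0 0 (2 * pi) = 0.
  apply: H => //.
  - by rewrite addr_gt0 // mulr_gt0.
  - move=> t; apply: (eq_cderiv (cderivD (cderiv_cst u)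
      (cderivM (real_deriv (shrink_deriv k)) (cderiv_cst (W t))))) => // x.
    by rewrite mulr0 addr0 add0r.
  - move=> x; apply: (eq_cderiv (cderivD (cderiv_cst u)
      (cderivZ (shrink k x)%:C dW))) => // t.
    by rewrite add0r.
  - move=> t; apply: ccontM; last exact: ccont_cst.
    have -> : (fun x => (shrink' k x)%:C) =
        (fun x => ((- 2 * k ^+ 2)%:C * x%:C) * (shrink k x)%:C ^+ 2).
      by apply/funext => x; rewrite /shrink' -!rmorphXn -!rmorphM /=; congr _%:C; ring.
    apply: ccontM; last exact: ccontX.
    apply: ccontZ; apply: cderiv_ccont (real_deriv (g' := fun=> 1) _) => x.
  - by move=> x; apply/ccontZ/ccontZ; apply: circle_cont.
  - move=> x t; rewrite Normc.normcM normc_real.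
    have := shrink'_le x k0; have := W_le t; have := normc_ge0 (W t).
    by have := normr_ge0 (shrink' k x); nra.
  - move=> x t; rewrite !Normc.normcM normc_real normc_circle ?(ltW r_gt0) //.
    rewrite (gtr0_norm (shrink_gt0 _ _)).
    have -> : normc 'i%C = 1 by rewrite /Normc.normc /= expr0n expr1n add0r sqrtr1.
    by have := shrink_gt0 k x; have := shrink_le1 k x; have := r_lt1; have := r_gt0; nra.
  - by move=> x t; apply: dF; [exact: homotopy_neq|exact: homotopy_lt1].
  - by rewrite mulr_gt0 // pi_gt0.
rewrite /boundary_integral /hedge /vedge !add0r.
have per x : homotopy k x (2 * pi) = homotopy k x 0 by rewrite /homotopy circle_2pi.
have -> : cint 0 (2 * pi) (fun x => F (homotopy k x (2 * pi)) * zx x (2 * pi)) =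
    cint 0 (2 * pi) (fun x => F (homotopy k x 0) * zx x 0).
  by apply: eq_cint => x; rewrite per /zx /W circle_2pi.
rewrite [X in X - _]addrAC addrN add0r => /eqP; rewrite subr_eq0 => /eqP ->.
rewrite /circle_integral -[LHS]/(cint 0 (2 * pi) _); apply: eq_cint => t.
have s0 : shrink k 0 = 1 by rewrite /shrink mulr0 expr0n addr0 invr1.
by rewrite /homotopy /zt s0 mul1r [u + _]addrC mul1r subrK.
Qed.

(** Differentiability of [f] at [u] makes the quotient bounded near [u]. The circle is deformed into
    a curve inside that neighbourhood, whose length is at most a multiple of s, so the integral is
    smaller than any [e]. *)
Lemma circle_integral_diff_quotient (f : C -> C) :
    (forall w, normc w < 1 -> derivable (f : K -> K) w 1) ->
  circle_integral r (fun w => (f w - f u) * (w - u)^-1) = 0.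
Proof.
move=> df; set F := fun w => _.
have u1 : normc u < 1 by apply: lt_trans u_lt r_lt1.
have dF w : w != u -> normc w < 1 -> exists l, cdiff F w l.
  move=> wu w1; apply: derivable_cdiff.
  exact: (@derivable_diff_quotient K f u w wu (df w w1)).
have [l /cdiff_lipschitz [d d0 H]] := derivable_cdiff (df u u1).
pose B := 1 + normc l.
have B0 : 0 < B by rewrite ltr_pwDl // normc_ge0.
have FB w : normc (w - u) < d -> normc (F w) <= B.
  (* At [u] itself the quotient is 0, because the inverse of 0 is 0. *)
  have [->|wu] := eqVneq w u.
    by rewrite /F !subrr mul0r Normc.normc0 => _; apply: ltW.
  move=> /H h; rewrite /F Normc.normcM Normc.normcV ler_pdivrMr //.
  by rewrite normc_gt0 subr_eq0.
have pi0 := pi_gt0 R.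
apply/eqP; rewrite -normc_eq0; apply/eqP/le_anti.
rewrite normc_ge0 andbT; apply/ler_addgt0Pr => e e0; rewrite add0r.
(* The term 2 / d brings the final curve, at distance at most 2 s from [u], within [d]; the last
   term makes the bound 4 pi B s at most [e]; the 1 keeps [k] above 1. *)
pose k := 1 + 2 / d + 4 * pi * B / e.
have h1 : 0 < 2 / d by rewrite divr_gt0.
have h2 : 0 < 4 * pi * B / e by rewrite divr_gt0 // !mulr_gt0.
have k1 : 1 < k by rewrite /k; lra.
have k0 : 0 < k by lra.
rewrite (shrink_circle_integral k0 dF).
set s := shrink k (2 * pi).
have s0 : 0 < s by apply: shrink_gt0.
have sk : s <= k^-1.
  rewrite lef_pV2 ?posrE ?den_gt0 //.
  have p1 : k <= k * (2 * pi) by rewrite ler_peMr ?(ltW k0) //; have := pi_ge2 R; lra.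
  by move: (k * _) p1 => p p1; nra.
have skd : s * 2 < d.
  apply: (@le_lt_trans _ _ (2 / k)); first by rewrite mulrC ler_pM2l.
  by rewrite ltr_pdivrMr // mulrC -ltr_pdivrMr // /k; lra.
have ske : 2 * (B * s) * (2 * pi - 0) <= e.
  apply: (@le_trans _ _ (4 * pi * B / k)).
    have -> : 2 * (B * s) * (2 * pi - 0) = 4 * pi * B * s by ring.
    by rewrite ler_pM2l // !mulr_gt0.
  by rewrite ler_pdivrMr // [e * k]mulrC -ler_pdivrMr // /k; lra.
apply: le_trans ske; apply: cint_le.
- apply: ccontM; last by apply/ccontZ/ccontZ; apply: circle_cont.
  apply: ccont_comp => [|t]; last first.
    by apply: dF; [exact: homotopy_neq|exact: homotopy_lt1].
  apply: ccontD; first exact: ccont_cst.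
  by apply/ccontZ/ccontB; [exact: circle_cont|exact: ccont_cst].
- by rewrite mulr_ge0 // ltW.
- move=> t _; rewrite Normc.normcM; apply: ler_pM; rewrite ?normc_ge0 //.
    apply: FB; rewrite /homotopy addrAC subrr add0r Normc.normcM normc_real gtr0_norm //.
    by apply: le_lt_trans skd; rewrite ler_pM2l // W_le.
  rewrite !Normc.normcM normc_real gtr0_norm // normc_circle ?(ltW r_gt0) //.
  have -> : normc 'i%C = 1 by rewrite /Normc.normc /= expr0n expr1n add0r sqrtr1.
  by rewrite mul1r ler_piMr // ltW.
Qed.

End Homotopy.

(** * Cauchy's formula for the derivatives *)

Section CauchyFormula.
Variable R : realType.
Local Notation C := R[i].
Local Notation normc := (@Normc.normc R).
Local Notation K := (R[i] : numFieldType).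
Variable r : R.
Hypothesis (r_gt0 : 0 < r) (r_lt1 : r < 1).
Implicit Types (u : C) (f : C -> C).

Lemma normc_i : normc 'i%C = 1.
Proof. by rewrite /Normc.normc /= expr0n expr1n add0r sqrtr1. Qed.

Lemma eq_circle_integral f1 f2 :
  (forall t, f1 (circle r t) = f2 (circle r t)) ->
  circle_integral r f1 = circle_integral r f2.
Proof. by move=> e; apply: (@eq_cint R 0 (2 * pi)) => t; rewrite e. Qed.

Lemma dcircle_cont : ccont (fun t => 'i%C * circle r t).
Proof. by apply/ccontZ/circle_cont. Qed.

Lemma circle_integralD f1 f2 :
    ccont (fun t => f1 (circle r t)) -> ccont (fun t => f2 (circle r t)) ->
  circle_integral r (fun w => f1 w + f2 w) = circle_integral r f1 + circle_integral r f2.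
Proof.
move=> c1 c2; rewrite -[RHS]/(cint 0 (2 * pi) _ + cint 0 (2 * pi) _) -cintD;
  try by apply: ccontM => //; apply: dcircle_cont.
by apply: (@eq_cint R 0 (2 * pi)) => t; rewrite mulrDl.
Qed.

Lemma circle_integralZ f c : ccont (fun t => f (circle r t)) ->
  circle_integral r (fun w => c * f w) = c * circle_integral r f.
Proof.
move=> cf; rewrite -[RHS]/(_ * cint 0 (2 * pi) _) -cintZ;
  last by apply: ccontM => //; apply: dcircle_cont.
by apply: (@eq_cint R 0 (2 * pi)) => t; rewrite -mulrA.
Qed.

Lemma circle_integral_sum (I : Type) (s : seq I) (G : I -> C -> C) :
  (forall i, ccont (fun t => G i (circle r t))) ->
  circle_integral r (fun w => \sum_(i <- s) G i w) =
  \sum_(i <- s) circle_integral r (G i).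
Proof.
move=> cG; rewrite -[RHS](@cint_sum R 0 (2 * pi) _ _
  (fun i t => G i (circle r t) * ('i%C * circle r t))); last first.
  by move=> i; apply: ccontM => //; apply: dcircle_cont.
by apply: (@eq_cint R 0 (2 * pi)) => t; rewrite mulr_suml.
Qed.

Lemma circle_integral0 : circle_integral r (fun=> 0) = 0.
Proof.
apply: etrans (@cint0 R 0 (2 * pi)).
apply: (@eq_cint R 0 (2 * pi) (fun t => 0 * ('i%C * circle r t))) => t.
by rewrite mul0r.
Qed.

Lemma circle_integral_le f (M : R) : ccont (fun t => f (circle r t)) ->
    (forall t, 0 <= t <= 2 * pi -> normc (f (circle r t)) <= M) ->
  normc (circle_integral r f) <= 4 * pi * M.
Proof.
move=> cf fM; have pi0 := pi_gt0 R.
have M0 : 0 <= M.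
  by apply: le_trans (fM 0 _); rewrite ?normc_ge0 // lexx mulr_ge0 // ltW.
have -> : 4 * pi * M = 2 * M * (2 * pi - 0) by ring.
apply: (@cint_le R 0 (2 * pi)); first by apply: ccontM => //; apply: dcircle_cont.
  by rewrite mulr_ge0 // ltW.
move=> t ht; rewrite Normc.normcM -[leRHS]mulr1 ler_pM ?normc_ge0 ?fM //.
by rewrite Normc.normcM normc_i mul1r normc_circle // ltW.
Qed.

Lemma circle_neq0 t : circle r t != 0.
Proof. by rewrite -normc_gt0 normc_circle // ltW. Qed.

(** The inverse of r e^(it) is r^-1 e^(-it), again a circle, so the derivative is read off the
    cosine and sine. *)
Lemma circle_inv_deriv :
  cderiv (fun t => (circle r t)^-1) (fun t => - 'i%C * (circle r t)^-1).
Proof.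
pose v t := circle r^-1 (- t).
have vE t : v t = (circle r t)^-1.
  apply: (mulfI (circle_neq0 t)); rewrite divff ?circle_neq0 // /v /circle cosN sinN.
  have h := cos2Dsin2 t; have r0 : r != 0 by rewrite lt0r_neq0.
  apply/eqP; rewrite eq_complex; apply/andP; split; apply/eqP.
    by rewrite [LHS]/= -[RHS]/1 -h; field.
  by rewrite [LHS]/= -[RHS]/0; field.
apply: (eq_cderiv (g := v) (g' := fun t => - 'i%C * v t)) => // [t|t]; last by rewrite vE.
split.
  rewrite (_ : _ \o _ = r^-1 *: cos); last by apply/funext => s; rewrite /v /= cosN.
  apply: (is_derive_eq (is_deriveZ _ (is_derive_cos t))).
  by rewrite /v /circle sinN cosN /GRing.scale /=; ring.
rewrite (_ : _ \o _ = (- r^-1) *: sin); last first.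
  by apply/funext => s; rewrite /v /= sinN -[RHS]/(- r^-1 * sin s); ring.
apply: (is_derive_eq (is_deriveZ _ (is_derive_sin t))).
by rewrite /v /circle sinN cosN /GRing.scale /=; ring.
Qed.

(** The power is a nonzero multiple of its own derivative and has period 2 pi. *)
Lemma cint_circle_inv_pow k : (0 < k)%N ->
  cint 0 (2 * pi) (fun t => (circle r t)^-1 ^+ k) = 0.
Proof.
case: k => // k _.
have cv := cderiv_ccont circle_inv_deriv.
have := cint_FTC (cderivX k.+1 circle_inv_deriv) _ (_ : 0 < 2 * pi).
rewrite circle_2pi subrr => /(_ _ _) H.
have {H} : cint 0 (2 * pi) (fun t => (- k.+1%:R * 'i%C) * (circle r t)^-1 ^+ k.+1) = 0.
  rewrite -[RHS]H; last by rewrite mulr_gt0 // pi_gt0.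
    by apply: eq_cint => t; rewrite exprS /=; ring.
  by apply: ccontM; [apply/ccontZ/ccontX|apply/ccontZ].
rewrite cintZ; last exact: ccontX.
move/eqP; rewrite mulf_eq0 => /orP [|/eqP //].
by rewrite mulNr oppr_eq0 mulf_eq0 pnatr_eq0 /= -normc_eq0 normc_i oner_eq0.
Qed.

Lemma ccont_circle_sub_inv u : normc u < r -> ccont (fun t => (circle r t - u)^-1).
Proof.
move=> ur; apply: ccontV => [|t]; last exact: circle_neq.
by apply: ccontB; [exact: circle_cont|exact: ccont_cst].
Qed.

Lemma circle_sub_le u t : normc u < r -> normc (circle r t - u)^-1 <= (r - normc u)^-1.
Proof.
move=> ur; rewrite Normc.normcV lef_pV2 ?posrE ?subr_gt0 ?normc_gt0 ?circle_neq //.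
rewrite lerBlDr -{1}(normc_circle t (ltW r_gt0)).
by rewrite -{1}[circle r t](subrK u) normc_add.
Qed.

(** A finite geometric sum in q = u / w turns i w / (w - u) into i, plus multiples of positive
    powers of 1 / w with integral 0, plus the remainder from [G]. The remainder is of size rho^(N+1)
    with rho = |u| / r < 1. *)
Lemma circle_integral_inv u : normc u < r ->
  circle_integral r (fun w => (w - u)^-1) = 2 * pi%:C * 'i%C.
Proof.
move=> ur; have pi0 := pi_gt0 R.
pose rho := normc u / r.
have rho0 : 0 <= rho by rewrite divr_ge0 ?normc_ge0 // ltW.
have rho1 : rho < 1 by rewrite ltr_pdivrMr // mul1r.
have ci := ccont_circle_sub_inv ur.
have cv := cderiv_ccont circle_inv_deriv.
have est N : normc (circle_integral r (fun w => (w - u)^-1) - 2 * pi%:C * 'i%C) <=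
    4 * pi * (r - normc u)^-1 * rho ^+ N.+1.
  pose G w := u ^+ N.+1 * w^-1 ^+ N.+1 * (w - u)^-1.
  have cG : ccont (fun t => G (circle r t)).
    by apply: ccontM => //; apply/ccontZ/ccontX.
  have -> : circle_integral r (fun w => (w - u)^-1) - 2 * pi%:C * 'i%C =
      circle_integral r G.
    apply/eqP; rewrite subr_eq addrC -subr_eq; apply/eqP.
    have cinv : ccont (fun t => (circle r t - u)^-1 * ('i%C * circle r t)).
      by apply: ccontM => //; apply: dcircle_cont.
    have cG' : ccont (fun t => G (circle r t) * ('i%C * circle r t)).
      by apply: ccontM => //; apply: dcircle_cont.
    rewrite -[LHS](@cintB R 0 (2 * pi) _ _ cinv cG').
    have -> : (fun t => (circle r t - u)^-1 * ('i%C * circle r t) -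
        G (circle r t) * ('i%C * circle r t)) =
        (fun t => 'i%C + \sum_(k < N) ('i%C * u ^+ k.+1) * (circle r t)^-1 ^+ k.+1).
      apply/funext => t; have c0 := circle_neq0 t; have cu := circle_neq r_gt0 ur t.
      pose q := u / circle r t.
      have -> : 'i%C + \sum_(k < N) 'i%C * u ^+ k.+1 * (circle r t)^-1 ^+ k.+1 =
          'i%C * \sum_(k < N.+1) q ^+ k.
        rewrite big_ord_recl expr0 mulrDr mulr1 mulr_sumr; congr (_ + _).
        by apply: eq_bigr => k _; rewrite -mulrA -exprMn.
      have -> : G (circle r t) = q ^+ N.+1 * (circle r t - u)^-1.
        by rewrite /G -exprMn.
      have h := subrX1 q N.+1.
      have -> : (circle r t - u)^-1 * ('i%C * circle r t) -
          q ^+ N.+1 * (circle r t - u)^-1 * ('i%C * circle r t) =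
          'i%C * (circle r t - u)^-1 * circle r t * - (q ^+ N.+1 - 1) by ring.
      rewrite h -mulNr opprB mulrA; congr (_ * _).
      by rewrite /q; field; rewrite c0 cu.
    rewrite cintD; [|exact: ccont_cst|by apply: ccont_sum => k; apply/ccontZ/ccontX].
    rewrite cint_sum => [|k]; last by apply/ccontZ/ccontX.
    rewrite big1 ?addr0 => [|k _]; last first.
      by rewrite cintZ ?cint_circle_inv_pow ?mulr0 //; apply: ccontX.
    rewrite (_ : (fun=> 'i%C) = fun=> 'i%C * 1); last first.
      by apply/funext => ?; rewrite mulr1.
    rewrite cintZ; last exact: ccont_cst.
    rewrite mulrC; congr (_ * _).
    rewrite (@cint_FTC R 0 (2 * pi) (fun t => t%:C)) ?mulr_gt0 //.
    + by rewrite subr0 rmorphM /= rmorph_nat.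
    + by apply: (real_deriv (g' := fun=> 1)) => t; apply: is_derive_id.
    + exact: ccont_cst.
  rewrite -mulrA; apply: circle_integral_le => // t _.
  rewrite mulrC; rewrite Normc.normcM ler_pM ?normc_ge0 ?circle_sub_le //.
  rewrite -exprMn normcX Normc.normcM Normc.normcV normc_circle //; exact: ltW.
apply/eqP; rewrite -subr_eq0 -normc_eq0; apply/eqP/le_anti.
rewrite normc_ge0 andbT; apply/ler_addgt0Pr => e e0; rewrite add0r.
pose B := 4 * pi * (r - normc u)^-1.
have B0 : 0 < B by rewrite !mulr_gt0 // invr_gt0 subr_gt0.
have : ((fun n => rho ^+ n) @ \oo --> (0 : R))%classic.
  by apply: cvg_expr; rewrite ger0_norm.
move/cvgrPdist_lt => /(_ (e / B)); rewrite divr_gt0 // => /(_ isT) [N _ /(_ N.+1)].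
rewrite /= sub0r normrN ger0_norm ?exprn_ge0 // => /(_ (leqnSn N)) h.
apply: le_trans (est N) _.
by rewrite mulrC -ler_pdivlMr // ltW.
Qed.

Variable f : C -> C.
Hypothesis f_holo : forall w, normc w < 1 -> derivable (f : K -> K) w 1.

Lemma f_circle_cont : ccont (fun t => f (circle r t)).
Proof.
apply: ccont_comp => [|t]; first exact: circle_cont.
by apply: derivable_cdiff; apply: f_holo; rewrite normc_circle // ltW.
Qed.

(** Here [k] is the exponent of the kernel: the derivative of order [k] belongs to index [k.+1]. *)
Definition cauchy_integral k u := circle_integral r (fun w => f w * (w - u)^-1 ^+ k).

Lemma cauchy_cont k u : normc u < r ->
  ccont (fun t => f (circle r t) * (circle r t - u)^-1 ^+ k).
Proof.
by move=> ur; apply: ccontM; [exact: f_circle_cont|apply/ccontX/ccont_circle_sub_inv].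
Qed.

Lemma cauchy_formula u : normc u < r -> cauchy_integral 1 u = 2 * pi%:C * 'i%C * f u.
Proof.
move=> ur; have ci := ccont_circle_sub_inv ur.
rewrite mulrC -(circle_integral_inv ur) -circle_integralZ //.
rewrite -[RHS]add0r -(circle_integral_diff_quotient r_gt0 r_lt1 ur f_holo).
rewrite -circle_integralD.
- by apply: eq_circle_integral => t; rewrite expr1; ring.
- apply: ccontM => //; apply: ccontB; [exact: f_circle_cont|exact: ccont_cst].
- exact: ccontZ.
Qed.

(** With a = 1 / (x - w), b = 1 / (x - u) and h = w - u, the relation a - b = h a b is the resolvent
    identity, and the bound is the first-order Taylor expansion of (x - w)^-m in w at u. The
    constant depends on [D] and [m] only, so it is uniform in x on the circle. *)
Lemma inv_pow_taylor (D : R) m : 0 < D -> exists2 B : R, 0 < B &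
  forall a b h : C, normc a <= D -> normc b <= D -> a - b = h * a * b ->
    normc (a ^+ m - b ^+ m - m%:R * h * b ^+ m.+1) <= B * normc h ^+ 2.
Proof.
move=> D0; elim: m => [|m [B B0 IH]].
  exists 1 => // a b h _ _ _.
  by rewrite !expr0 subrr !mul0r subr0 Normc.normc0 mul1r exprn_ge0 // normc_ge0.
exists (D * B + m.+1%:R * (D * D ^+ m.+2)).
  have Dm : 0 < D ^+ m.+2 by apply: exprn_gt0.
  by apply: addr_gt0; apply: mulr_gt0 => //; apply: mulr_gt0.
move=> a b h aD bD ab.
have -> : a ^+ m.+1 - b ^+ m.+1 - m.+1%:R * h * b ^+ m.+2 =
    a * (a ^+ m - b ^+ m - m%:R * h * b ^+ m.+1) + m.+1%:R * h ^+ 2 * (a * b ^+ m.+2).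
  have h1 : h * b ^+ m.+1 * (a - b) = h ^+ 2 * (a * b ^+ m.+2).
    by rewrite ab (exprS b m.+1); ring.
  have n1 : m.+1%:R = m%:R + 1 :> C by rewrite -addn1 natrD.
  rewrite -[X in _ = _ + X]mulrA -h1 n1.
  apply/eqP; rewrite -subr_eq0 !exprS.
  rewrite (_ : _ - _ = (a - b - h * a * b) * b ^+ m); last by ring.
  by rewrite ab subrr mul0r.
apply: le_trans (normc_add _ _) _; rewrite mulrDl; apply: lerD.
  rewrite Normc.normcM -(mulrA D); apply: ler_pM => //; rewrite ?normc_ge0 //.
  exact: IH.
have -> : normc (m.+1%:R * h ^+ 2 * (a * b ^+ m.+2)) =
    m.+1%:R * (normc a * normc b ^+ m.+2) * normc h ^+ 2.
  rewrite Normc.normcM [X in X * _]Normc.normcM [X in _ * X]Normc.normcM.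
  rewrite (normcX h 2) (normcX b m.+2) -(rmorph_nat (real_complex R)).
  by rewrite normc_real normr_nat; ring.
rewrite ler_wpM2r ?exprn_ge0 ?normc_ge0 // ler_wpM2l // ler_pM ?exprn_ge0 ?normc_ge0 //.
by rewrite lerXn2r // nnegrE ?normc_ge0 // ltW.
Qed.

(** Differentiation under the integral sign: the remainder of the kernel is quadratic in w - u
    uniformly on the circle, and [f] is bounded there. *)
Lemma cauchy_integral_cdiff k u : normc u < r ->
  cdiff (cauchy_integral k) u (k%:R * cauchy_integral k.+1 u).
Proof.
move=> ur e e0; have pi0 := pi_gt0 R.
(* Half the gap between |u| and r: for |w - u| < d both [u] and [w] keep distance at least [d] from
   the circle. *)
pose d := (r - normc u) / 2.
have d0 : 0 < d by rewrite divr_gt0 // subr_gt0.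
have [Bf Bf0 fB] : exists2 B : R, 0 < B &
    forall t, 0 <= t <= 2 * pi -> normc (f (circle r t)) <= B.
  apply: ccont_bounded; last exact: f_circle_cont.
  by rewrite mulr_ge0 // ltW.
have D0 : 0 < d^-1 by rewrite invr_gt0.
have [B B0 HB] := inv_pow_taylor k D0.
pose M := 4 * pi * (Bf * B).
have M0 : 0 < M by rewrite !mulr_gt0.
(* Below e / M the quadratic error M |w - u|^2 is at most e |w - u|. *)
exists (Num.min d (e / M)); first by rewrite lt_min d0 divr_gt0.
move=> w; rewrite lt_min => /andP [wd we].
have wr : normc w < r.
  rewrite -[w](subrK u); apply: le_lt_trans (normc_add _ _) _.
  by move: wd; rewrite /d; lra.
have inv_le v t : normc v <= normc u + d -> normc v < r ->
    normc (circle r t - v)^-1 <= d^-1.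
  move=> vd vr; apply: le_trans (circle_sub_le t vr) _.
  rewrite lef_pV2 ?posrE ?subr_gt0 //; move: vd; rewrite /d; lra.
have ud : normc u <= normc u + d by rewrite lerDl ltW.
have wud : normc w <= normc u + d.
  rewrite -{1}[w](subrK u); apply: le_trans (normc_add _ _) _.
  by rewrite addrC lerD2l ltW.
pose E x := f x * ((x - w)^-1 ^+ k - (x - u)^-1 ^+ k -
  k%:R * (w - u) * (x - u)^-1 ^+ k.+1).
have -> : cauchy_integral k w - cauchy_integral k u -
    k%:R * cauchy_integral k.+1 u * (w - u) =
    circle_integral r E.
  have cw := cauchy_cont k wr; have cu := cauchy_cont k ur.
  have cu1 := cauchy_cont k.+1 ur.
  have -> : cauchy_integral k w - cauchy_integral k u -
    k%:R * cauchy_integral k.+1 u * (w - u) =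
      cauchy_integral k w + (- 1 * cauchy_integral k u +
        - (k%:R * (w - u)) * cauchy_integral k.+1 u).
    move: (cauchy_integral k w) (cauchy_integral k u) (cauchy_integral k.+1 u) => x y z.
    ring.
  have zu := ccontZ (-1) cu; have zu1 := ccontZ (- (k%:R * (w - u))) cu1.
  rewrite /cauchy_integral -(circle_integralZ _ cu) -(circle_integralZ _ cu1).
  rewrite -(circle_integralD zu zu1) -(circle_integralD cw (ccontD zu zu1)).
  by apply: eq_circle_integral => t; rewrite /E; ring.
apply: (@le_trans _ _ (M * normc (w - u) ^+ 2)).
  rewrite /M -mulrA; apply: circle_integral_le.
    apply: ccontM; first exact: f_circle_cont.
    apply: ccontB; [apply: ccontB; apply/ccontX|apply/ccontZ/ccontX];
      exact: ccont_circle_sub_inv.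
  move=> t ht; rewrite /E Normc.normcM -[leRHS]mulrA ler_pM ?normc_ge0 ?fB //.
  apply: HB; [exact: inv_le|exact: inv_le|].
  have cu := circle_neq r_gt0 ur t; have cw := circle_neq r_gt0 wr t.
  by field; rewrite cu cw.
rewrite expr2 mulrA ler_wpM2r ?normc_ge0 //.
by rewrite mulrC -ler_pdivlMr // ltW.
Qed.

Lemma eq_cdiff (F G : C -> C) u l (d : R) : 0 < d ->
  (forall w, normc (w - u) < d -> F w = G w) -> cdiff F u l -> cdiff G u l.
Proof.
move=> d0 FG dF e e0; have [d' d'0 H] := dF e e0.
exists (Num.min d d'); first by rewrite lt_min d0.
move=> w; rewrite lt_min => /andP [wd wd'].
by rewrite -!FG ?H // subrr Normc.normc0.
Qed.

Lemma cdiffZ (F : C -> C) c u l : cdiff F u l -> cdiff (fun w => c * F w) u (c * l).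
Proof.
move=> dF e e0; have c0 : 0 < 1 + normc c by rewrite ltr_pwDl // normc_ge0.
have [|d d0 H] := dF (e / (1 + normc c)); first by rewrite divr_gt0.
exists d => // w /H h.
have -> : c * F w - c * F u - c * l * (w - u) = c * (F w - F u - l * (w - u)) by ring.
rewrite Normc.normcM.
apply: (@le_trans _ _ ((1 + normc c) * normc (F w - F u - l * (w - u)))).
  by rewrite ler_wpM2r ?normc_ge0 // lerDr.
rewrite mulrC -ler_pdivlMr //; apply: le_trans h _.
by rewrite mulrAC.
Qed.

Lemma derive1n_cauchy k u : normc u < r ->
  derive1n k (f : K -> K) u = (2 * pi%:C * 'i%C)^-1 * (k`!%:R * cauchy_integral k.+1 u).
Proof.
have p0 : 2 * pi%:C * 'i%C != 0 :> C.
  rewrite -normc_eq0 !Normc.normcM normc_i mulr1 -(rmorph_nat (real_complex R)).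
  by rewrite !normc_real mulf_neq0 // normr_eq0 ?pnatr_eq0 // lt0r_neq0 // pi_gt0.
(* The point stays general, since differentiating at [u] uses the formula at all nearby points. *)
elim: k u => [|k IH] u ur.
  by rewrite derive1n0 cauchy_formula // fact0 mul1r mulKf.
rewrite derive1nS; apply: cdiff_derive1.
have d0 : 0 < r - normc u by rewrite subr_gt0.
apply: (eq_cdiff d0 (F := fun w =>
    (2 * pi%:C * 'i%C)^-1 * (k`!%:R * cauchy_integral k.+1 w))).
  move=> w wu; rewrite IH //; rewrite -[w](subrK u).
  by apply: le_lt_trans (normc_add _ _) _; rewrite -ltrBrDr.
have -> : k.+1`!%:R * cauchy_integral k.+2 u =
    k`!%:R * (k.+1%:R * cauchy_integral k.+2 u).
  by rewrite factS natrM; ring.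
by apply/cdiffZ/cdiffZ/cauchy_integral_cdiff.
Qed.

End CauchyFormula.

(** * The functional calculus on Jordan blocks *)

Section Resolvent.
Variable K : closedFieldType.

(** The inverse of (z - u) - N is the geometric series of N^k / (z - u)^(k+1), finite as N is
    nilpotent. *)
Lemma resolvent_jordan_block l (u z : K) : z != u ->
  (z%:M - jordan_block u l) *m toeplitz l (fun k => (z - u)^-1 ^+ k.+1) = 1%:M.
Proof.
rewrite -subr_eq0 => zu.
have -> : z%:M - jordan_block u l = (z - u)%:M - shift_mx K l 1.
  apply/matrixP => i j; rewrite !mxE addn1 -!val_eqE /= (eq_sym (j : nat)).
  by rewrite opprD addrA -mulrnBl.
rewrite mulmxBl mul_scalar_mx; apply/matrixP => i j; rewrite !mxE.
under eq_bigr do rewrite !mxE; rewrite sum_indicator addn1 -val_eqE /=.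
have -> : oapp (fun k : 'I_l => if (k <= j)%N then (z - u)^-1 ^+ (j - k).+1 else 0) 0
    (insub i.+1) = if (i < j)%N then (z - u)^-1 ^+ (j - i.+1).+1 else 0.
  case: insubP => [k0 _ /= -> //|] /=; rewrite -leqNgt => h.
  by case: leqP => // ij; have := ltn_ord j; lia.
case: ltngtP => [ij|ji|<-]; last by rewrite subnn expr1 mulfV // subr0.
  by rewrite subnSK // exprS mulrA mulfV // mul1r subrr.
by rewrite mulr0 subrr.
Qed.

(** The position of an entry is found before the blocks are given, so one choice serves every [T];
    the blocks of the resolvent vary with the point of the contour. *)
Lemma mxdiag_entry m (l : 'I_m -> nat) (a b : 'I_(\sum_i l i)) :
  (exists i (x y : 'I_(l i)),
     forall T : forall i, 'M[K]_(l i), (\mxdiag_i T i) a b = T i x y)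
  \/ forall T : forall i, 'M[K]_(l i), (\mxdiag_i T i) a b = 0.
Proof.
have E (T : forall i, 'M[K]_(l i)) : (\mxdiag_i T i) a b =
    (if tagnat.sig1 a == tagnat.sig1 b then conform_mx 0 (T (tagnat.sig1 a)) else 0)
    (tagnat.sig2 a) (tagnat.sig2 b) by rewrite mxE.
move: (tagnat.sig1 a) (tagnat.sig2 a) (tagnat.sig1 b) (tagnat.sig2 b) E => i x i' y E.
have [ii'|ii'] := eqVneq i i'; last first.
  by right=> T; rewrite E (negbTE ii') mxE.
by left; subst i'; exists i, x, y => T; rewrite E eqxx conform_mx_id.
Qed.

Lemma mul_mxdiag m (l : 'I_m -> nat) (S T : forall i, 'M[K]_(l i)) :
  (\mxdiag_i S i) *m (\mxdiag_i T i) = \mxdiag_i (S i *m T i).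
Proof.
rewrite {2}/mxdiag mul_mxdiag_mxblock.
apply/eq_mxblock => i j; case: eqVneq => [->|]; last by rewrite mulmx0.
by rewrite !conform_mx_id.
Qed.

(** After subtracting [u i], block [i] loses one from its rank while no other block exceeds its
    size, so the total rank is below [n]. *)
Lemma eigenvalue_jordan_form n (A : 'M[K]_n) m (u : 'I_m -> K) l i :
  is_jordan_form A u l -> eigenvalue A (u i).
Proof.
move=> [l0 jA]; have := rank_block_similar (u i) 1 jA; rewrite !expr1.
rewrite /eigenvalue /eigenspace kermx_eq0 /row_free => ->.
have [e _] := jA; rewrite -[X in _ != X]e {jA}.
rewrite neq_ltn; apply/orP; left.
rewrite [ltnLHS](bigD1 i) //= [ltnRHS](bigD1 i) //= -addSn leq_add //.
  rewrite jordan_block_toeplitz toeplitz_subC -[toeplitz _ _]expr1.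
  rewrite (@rank_toeplitzX _ _ _ 1) ?muln1 /= ?oppr0 ?addr0 ?oner_neq0 //.
    by rewrite subn1 prednK.
  by case=> // _; rewrite eqxx subrr.
by apply: leq_sum => j _; apply: rank_leq_row.
Qed.

Lemma invmx_unique n (A B : 'M[K]_n) : A *m B = 1%:M -> invmx A = B.
Proof.
by move=> AB; have [uA _] := mulmx1_unit AB; rewrite -[B](mulKmx uA) AB mulmx1.
Qed.

End Resolvent.

(** The two difference quotients coincide as functions, hence so do all derivatives of positive
    order. *)
Lemma derive1n_subC (K : numFieldType) (F : K -> K) c k : (0 < k)%N ->
  derive1n k (fun w => F w - c) = derive1n k F.
Proof.
case: k => // k _; rewrite !derive1Sn.
suff -> : derive1 (fun w => F w - c) = derive1 F by [].
apply/funext => w; rewrite /derive1.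
suff -> : (fun h => h^-1 *: (F (h + w) - c - (F w - c))) =
          (fun h => h^-1 *: (F (h + w) - F w)) by [].
by apply/funext => h; congr (_ *: _); rewrite opprB addrA subrK.
Qed.

Section FunctionalCalculus.
Variable R : realType.
Local Notation C := R[i].
Local Notation normc := (@Normc.normc R).
Local Notation K := (R[i] : numFieldType).
Variable r : R.
Hypothesis (r_gt0 : 0 < r) (r_lt1 : r < 1).
Variable f : C -> C.
Hypothesis f_holo : forall w, normc w < 1 -> derivable (f : K -> K) w 1.

(** This is f^(k)(u) / k! when |u| < r, kept as a Cauchy integral because the entries of
    [holo_calculus] arrive in that form. *)
Definition taylor_coef (u : C) (k : nat) : C :=
  (2 * pi%:C * 'i%C)^-1 * cauchy_integral r f k.+1 u.

Lemma natr_complex_neq0 k : (0 < k)%N -> k%:R != 0 :> C.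
Proof. by move=> k0; rewrite pnatr_eq0 -lt0n. Qed.

Lemma derive1n_taylor_coef k u : normc u < r ->
  derive1n k (f : K -> K) u = k`!%:R * taylor_coef u k.
Proof.
move=> ur; rewrite (derive1n_cauchy r_gt0 r_lt1 f_holo) // /taylor_coef.
by rewrite mulrCA.
Qed.

Lemma taylor_coef0 u : normc u < r -> taylor_coef u 0 = f u.
Proof. by move=> ur; have := derive1n_taylor_coef 0 ur; rewrite mul1r => <-. Qed.

Lemma taylor_coef_eq0 k u : normc u < r ->
  (taylor_coef u k == 0) = (derive1n k (f : K -> K) u == 0).
Proof.
move=> ur; have := mulf_eq0 (k`!%:R : C) (taylor_coef u k).
by rewrite (negbTE (natr_complex_neq0 (fact_gt0 k))) derive1n_taylor_coef.
Qed.

Lemma degree_at_spec u : normc u < r ->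
  order_spec (taylor_coef u) (degree_at (f : K -> K) u).
Proof.
move=> ur; rewrite /degree_at /zero_order.
set g : K -> K := fun w => _.
have gE k : (0 < k)%N -> (derive1n k g u == 0) = (taylor_coef u k == 0).
  by move=> k0; rewrite (@derive1n_subC K f (f u) k k0) taylor_coef_eq0.
have g0 : derive1n 0 g u = 0 by rewrite derive1n0 /g subrr.
case: pselect => [h|nh] /=.
  case: ex_minnP => d gd dmin.
  have d0 : (0 < d)%N by case: d gd {dmin} => //; rewrite g0 eqxx.
  split => // [j /andP [j0 jd]|]; last by rewrite -gE.
  apply/eqP; rewrite -gE //; apply/negPn/negP => /dmin.
  by rewrite leqNgt jd.
move=> j j0; apply/eqP; rewrite -gE //; apply/negPn/negP => h.
by apply: nh; exists j.
Qed.

(** On the contour the resolvent of [A] is a fixed conjugate of the block resolvents. Linearity of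
    the integral pulls the constant conjugating matrices out, and the entries (z - u)^-(k+1) of the
    blocks integrate to Taylor coefficients. *)
Lemma holo_calculus_jordan_form n (A : 'M[C]_n) m (u : 'I_m -> C) l :
    is_jordan_form A u l -> (forall i, normc (u i) < r) ->
  block_similar (holo_calculus r f A) (fun i => toeplitz (l i) (taylor_coef (u i))).
Proof.
move=> [_ /block_similarE [e [P uP AE]]] ur; exists e; exists P => //.
apply/(simmxP uP).
have fc : ccont (fun t => f (circle r t)) by apply: f_circle_cont.
subst n; rewrite castmx_id in AE *.
pose T z i : 'M[C]_(l i) := toeplitz (l i) (fun k => (z - u i)^-1 ^+ k.+1).
pose M z := \mxdiag_i T z i.
have inv z : (forall i, z != u i) -> invmx (z%:M - A) = invmx P *m M z *m P.
  move=> zu; apply: invmx_unique; rewrite AE.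
  have -> : z%:M = invmx P *m z%:M *m P.
    by rewrite scalar_mxC -mulmxA mulVmx // mulmx1.
  rewrite -mulmxBl -mulmxBr -(mxdiagZ z) -mxdiagB !mulmxA.
  rewrite mulmxK // -[X in X *m P]mulmxA mul_mxdiag.
  under eq_mxdiag do rewrite resolvent_jordan_block //.
  by rewrite mxdiagZ mulmx1 mulVmx.
have cM a b : ccont (fun t => M (circle r t) a b).
  have [[i [x [y E]]]|E] := mxdiag_entry R[i] a b; last first.
    by under eq_fun do rewrite /M E; apply: ccont_cst.
  under eq_fun do rewrite /M E mxE.
  case: leqP => _; last exact: ccont_cst.
  by apply/ccontX/ccont_circle_sub_inv.
have cfM a b : ccont (fun t => f (circle r t) * M (circle r t) a b) by apply: ccontM.
pose H := \matrix_(a, b)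
  ((2 * pi%:C * 'i%C)^-1 * circle_integral r (fun z => f z * M z a b)).
have HE : H = \mxdiag_i toeplitz (l i) (taylor_coef (u i)).
  apply/matrixP => a b; rewrite mxE.
  have [[i [x [y E]]]|E] := mxdiag_entry R[i] a b; rewrite E; last first.
    rewrite (@eq_circle_integral _ _ _ (fun=> 0)) ?circle_integral0 ?mulr0 //.
    by move=> t; rewrite /M E mulr0.
  rewrite mxE; case: leqP => xy.
    by congr (_ * _); apply: eq_circle_integral => t; rewrite /M E mxE xy.
  rewrite (@eq_circle_integral _ _ _ (fun=> 0)) ?circle_integral0 ?mulr0 //.
  by move=> t; rewrite /M E mxE leqNgt xy mulr0.
rewrite -HE.
suff -> : holo_calculus r f A = invmx P *m H *m P by rewrite mulmxA mulKVmx.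
apply/matrixP => i j; rewrite !mxE.
rewrite (@eq_circle_integral _ _ _ (fun z =>
  \sum_b \sum_a invmx P i a * P b j * (f z * M z a b))); last first.
  move=> t; rewrite inv => [|k]; last first.
    by rewrite -subr_eq0; apply: circle_neq.
  rewrite mxE mulr_sumr; apply: eq_bigr => b _.
  rewrite mxE mulr_suml mulr_sumr; apply: eq_bigr => a _; ring.
rewrite circle_integral_sum => [|b]; last by apply: ccont_sum => a; apply: ccontZ.
rewrite mulr_sumr; apply: eq_bigr => b _.
rewrite circle_integral_sum => [|a]; last exact: ccontZ.
rewrite mulr_sumr mxE mulr_suml; apply: eq_bigr => a _.
by rewrite circle_integralZ // !mxE; ring.
Qed.

End FunctionalCalculus.

Theorem theorem5p6 (R : realType) (n : nat) (A1 A2 A : 'M[R[i]]_n)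
    (phi : R[i] -> R[i]) (r : R)
    (hA1 : A1 \is hermsymmx) (hA2 : A2 \is hermsymmx)
    (hA : A = A1 + 'i%C *: A2)
    (hspec : forall z : R[i], eigenvalue A z -> `|z| < 1)
    (hphi_disc : forall z : R[i], `|z| < 1 -> `|phi z| < 1)
    (hphi_holo : holomorphic_on_disc phi)
    (hr : admissible_radius A r) :
  sp (holo_calculus r phi A) = mset_map (phi_star phi) (sp A).
Proof.
have [r0 r1 hAr] := hr.
have [m [u [l jA]]] := jordan_form_exists A.
(* The diagonal values of the Jordan form are eigenvalues, so the contour encloses them. *)
have ur i : Normc.normc (u i) < r.
  by rewrite -ltcR -norm_complexE; apply: hAr; apply: eigenvalue_jordan_form jA.
have holo w : Normc.normc w < 1 ->
    derivable (phi : (R[i] : numFieldType) -> (R[i] : numFieldType)) w 1.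
  by move=> w1; apply: hphi_holo; have := norm_complexE w => ->; rewrite ltcR.
apply: (sp_block_similar jA (holo_calculus_jordan_form r0 r1 holo jA ur)).
  by move=> i; apply: degree_at_spec.
by move=> i j; rewrite (taylor_coef0 r0 r1 holo).
Qed.
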